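(* Let $n,t\in\mathbf{N}$, $d\ge1$, let $q$ be a power of an odd prime, and let $A\subseteq\mathbf{F}_q^d$ with $|A|=\alpha q^d$ where $\alpha \geq 12 n^2 q^{t-\frac{d+1}{2}}$. Let $\mathcal{G}=(V,E)$ be any distance graph with vertex set $V=\{v_1,\dots,v_n\}$, $m$ edges, and maximum vertex degree $t$. Then the number of $n$-tuples $(x_1,\dots,x_n)$ of pairwise distinct points of $A$ such that $|x_i-x_j|^2=\lambda_{e_{i,j}}$ whenever $v_i$ and $v_j$ are adjacent is at least $\tfrac12 |A|^n q^{-m}$. In particular, $A$ contains at least $\tfrac12|A|^n q^{-m}$ (ordered) isometric copies of $\mathcal{G}$.
   Context: $\mathbf{F}_q$ is the finite field with $q$ elements (odd characteristic). For $v\in\mathbf{F}_q^d$, $|v|^2 := \sum_{j=1}^d v_j^2$. A distance graph is a finite simple graph $\mathcal{G}=(V,E)$ together with a nonzero length $\lambda_e\in\mathbf{F}_q^*$ for each edge $e$; the edge joining $v_i$ and $v_j$ is denoted $e_{i,j}$. An isometric copy of $\mathcal{G}$ is a set $X\subseteq\mathbf{F}_q^d$ with a bijection $\varphi:V\to X$ such that $|\varphi(v)-\varphi(w)|^2=\lambda_e$ whenever $v,w$ are joined by the edge $e$; an ordered isometric copy is the tuple $(\varphi(v_1),\dots,\varphi(v_n))$. *)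

(* Defs.v *)
From HB Require Import structures.
From mathcomp Require Import all_boot all_order all_algebra all_field.
Set Implicit Arguments. Unset Strict Implicit. Unset Printing Implicit Defensive.
Import Order.TTheory GRing.Theory Num.Theory.
Local Open Scope ring_scope.

Definition sqnorm (F : fieldType) (d : nat) (v : 'rV[F]_d) : F :=
  \sum_(j < d) v ord0 j ^+ 2.

Definition is_distance_graph (F : fieldType) (n : nat)
  (E : {set {set 'I_n}}) (lam : {set 'I_n} -> F) : Prop :=
  forall e, e \in E -> #|e| = 2%N /\ lam e != 0.

Definition vdeg (n : nat) (E : {set {set 'I_n}}) (v : 'I_n) : nat :=
  #|[set e in E | v \in e]|.

Definition iso_copies (F : finFieldType) (d n : nat)
  (E : {set {set 'I_n}}) (lam : {set 'I_n} -> F) (A : {set 'rV[F]_d})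
  : {set {ffun 'I_n -> 'rV[F]_d}} :=
  [set x : {ffun 'I_n -> 'rV[F]_d} |
     [&& injectiveb x, [forall i, x i \in A] &
         [forall i, forall j, ([set i; j] \in E) ==>
                                (sqnorm (x i - x j) == lam [set i; j])]]].

(* Main.v *)
Require Import Defs.
From HB Require Import structures.
From mathcomp Require Import all_boot all_order all_algebra all_field.
From mathcomp Require Import fingroup action finalg classfun character.
From mathcomp Require Import ring lra zify.
Set Implicit Arguments. Unset Strict Implicit. Unset Printing Implicit Defensive.
Import Order.TTheory GRing.Theory Num.Theory.
Local Open Scope ring_scope.

(** Let q = |F| and let N(E) count the maps x from the vertices to A that
    respect the edges E, injective or not.  The indicator of a sphere minus its
    density 1/q is a convolution kernel whose Fourier coefficients are at most
    2 q^((d-1)/2).  Applied to the two endpoints of an edge ij, with the other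
    vertices fixed and then summed by Cauchy-Schwarz, this gives
    (q N(E) - N(E - ij))^2 <= 4 q^(d+1) N(G - i) N(G - j), G - i being the graph
    with the vertex i removed.  By induction on the edges N(E) differs from
    |A|^n q^(-m) by at most |A|^n q^(-m) / 11, and the non-injective maps number
    at most as many.

    The Fourier coefficients are Salie sums for odd d, evaluated by completing
    squares, and Kloosterman sums K(a, b) for even d, for which Weil's bound
    |K| <= 2 sqrt q is needed.  It is proved as follows.  Passing to the
    quadratic extension replaces K by 2 q - K^2, so that if K^2 > 4 q, then along
    the tower of fields of Q = q^(2^n) elements the sums become more negative
    than any multiple of sqrt Q, whereas none of them exceeds 2 sqrt Q.  But the
    sum of the K(ca, cb) over c <> 0 in F counts the points of
    y^q - y = a x + b / x, that is of v^2 = (y^q - y)^2 - 4 a b, and Stepanov's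
    method shows that there are at least Q - O(sqrt Q) of them. *)

(** * Quadratic and additive characters *)

Lemma card_finField_gt1 (F : finFieldType) : (1 < #|F|)%N.
Proof. exact: finNzRing_gt1. Qed.

Lemma card_finField_pchar (F : finFieldType) (p : nat) :
  p \in [pchar F] -> #|F| = (p ^ logn p #|F|)%N.
Proof. exact: card_pprimeChar. Qed.

Lemma odd_card_two_neq0 (F : finFieldType) : odd #|F| -> 2%:R != 0 :> F.
Proof.
move=> oddF; have [p p_pr pF] := finPcharP F.
rewrite -(dvdn_pcharf pF) dvdn_prime2 //; apply/eqP => p2; subst p; move: oddF.
rewrite (card_finField_pchar pF) oddX /= orbF => /eqP E.
by have := card_finField_gt1 F; rewrite (card_finField_pchar pF) E.
Qed.

Lemma pchar_nat_card (F : finFieldType) (L : fieldType)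
    (iota : {rmorphism F -> L}) : [pchar L].-nat #|F|.
Proof.
have [p p_pr pF] := finPcharP F.
rewrite (card_finField_pchar pF) pnatX pnatE ?(rmorph_pchar iota) //.
Qed.

Lemma card_finField_odd (F : finFieldType) :
  odd #|F| -> #|F| = (#|F|.-1)./2.*2.+1.
Proof.
move=> oddF; have := odd_double_half #|F|.-1.
by case: #|F| oddF (card_finField_gt1 F) => //= m /negbTE ->; rewrite add0n => _ ->.
Qed.

Section QuadraticCharacter.

Variable F : finFieldType.
Hypothesis oddF : odd #|F|.

Let two_neq0 : 2%:R != 0 :> F. Proof. exact: odd_card_two_neq0. Qed.

Definition nsqrt (u : F) : nat := #|[set x : F | x ^+ 2 == u]|.

(** The Legendre symbol. Defined by counting square roots, it turns sums over x^2 into twisted sums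
    at once; multiplicativity is left to Euler's criterion. *)
Definition qchar (u : F) : algC := (nsqrt u)%:R - 1.

Lemma nsqrt_sqr (c : F) : c != 0 -> nsqrt (c ^+ 2) = 2%N.
Proof.
move=> c0; rewrite /nsqrt.
have -> : [set x | x ^+ 2 == c ^+ 2] = [set c; - c].
  by apply/setP=> x; rewrite !inE eqf_sqr.
by rewrite cards2 -addr_eq0 -mulr2n -mulr_natl mulf_neq0.
Qed.

Lemma nsqrt0 : nsqrt 0 = 1%N.
Proof.
rewrite /nsqrt; have -> : [set x : F | x ^+ 2 == 0] = [set 0].
  by apply/setP=> x; rewrite !inE expf_eq0.
by rewrite cards1.
Qed.

Lemma sum_sqr (V : nmodType) (g : F -> V) :
  \sum_x g (x ^+ 2) = \sum_u g u *+ nsqrt u.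
Proof.
rewrite (partition_big (fun x : F => x ^+ 2) xpredT) //=.
apply: eq_bigr => u _.
rewrite (eq_bigr (fun=> g u)); last by move=> x /eqP ->.
rewrite sumr_const; congr (_ *+ _).
by apply: eq_card => x; rewrite !inE.
Qed.

Lemma expf_pred (x : F) : x != 0 -> x ^+ #|F|.-1 = 1.
Proof.
move=> x0; apply: (mulfI x0); rewrite -exprS mulr1.
by rewrite prednK ?expf_card // (cardD1 0) inE.
Qed.

Lemma euler_pm1 (x : F) : x != 0 ->
  (x ^+ (#|F|.-1)./2 == 1) || (x ^+ (#|F|.-1)./2 == - 1).
Proof.
move=> x0; rewrite -eqf_sqr expr1n -exprM muln2.
by apply/eqP; rewrite -(expf_pred x0) [in RHS](card_finField_odd oddF).
Qed.

Lemma card_nz_squares :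
  #|[set u : F | (u != 0) && (0 < nsqrt u)%N]| = (#|F|.-1)./2.
Proof.
have E : #|F| = (1 + #|[set u : F | (u != 0%R) && (0 < nsqrt u)%N]| * 2)%N.
  have := @sum_sqr nat (fun=> 1%N); rewrite sum1_card => ->.
  rewrite (bigD1 0) //= nsqrt0; congr (_ + _)%N.
  rewrite -sum_nat_const [RHS]big_mkcond [LHS]big_mkcond /=.
  apply: eq_bigr => u _; rewrite !inE; case: eqVneq => //= u0.
  case: (posnP (nsqrt u)) => [-> //|].
  rewrite card_gt0 => /set0Pn [c]; rewrite inE => /eqP cu.
  by rewrite -cu nsqrt_sqr //; move: u0; rewrite -cu expf_eq0.
have := card_finField_odd oddF; lia.
Qed.

(** With q = |F|, the (q - 1)/2 nonzero squares already exhaust the roots of X^((q - 1)/2) - 1. *)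
Lemma euler_criterion (u : F) : u != 0 ->
  (u ^+ (#|F|.-1)./2 == 1) = (0 < nsqrt u)%N.
Proof.
have h0 : (0 < (#|F|.-1)./2)%N.
  have := card_finField_odd oddF; have := card_finField_gt1 F; lia.
set S := [set u : F | (u != 0) && (0 < nsqrt u)%N].
have SP v : v \in S -> v ^+ (#|F|.-1)./2 == 1.
  rewrite inE => /andP [v0]; rewrite card_gt0 => /set0Pn [c]; rewrite inE.
  move=> /eqP cv; rewrite -cv -exprM mul2n.
  have c0 : c != 0 by move: v0; rewrite -cv expf_eq0.
  by apply/eqP; rewrite -(expf_pred c0) [in RHS](card_finField_odd oddF).
move=> u0; apply/idP/idP => [u1|up]; last by apply: SP; rewrite inE u0.
case: (boolP (u \in S)) => [|uS]; first by rewrite inE => /andP [].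
have rS : all (root ('X^((#|F|.-1)./2) - 1)) (u :: enum S).
  apply/allP => v; rewrite inE mem_enum => vS.
  have /eqP E : v ^+ (#|F|.-1)./2 == 1 by case/predU1P: vS => [->|/SP].
  by rewrite /root !hornerE E subrr.
have p0 : 'X^((#|F|.-1)./2) - 1 != 0 :> {poly F}.
  by rewrite -size_poly_eq0 size_XnsubC.
have := max_poly_roots p0 rS; rewrite /= mem_enum uS enum_uniq size_XnsubC //.
by rewrite -cardE card_nz_squares ltnn => /(_ isT).
Qed.

Lemma qchar0 : qchar 0 = 0.
Proof. by rewrite /qchar nsqrt0 subrr. Qed.

Lemma qcharE (u : F) : u != 0 ->
  qchar u = if u ^+ (#|F|.-1)./2 == 1 then 1 else - 1.
Proof.
move=> u0; rewrite euler_criterion // /qchar.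
case: (posnP (nsqrt u)) => [-> | ]; first by rewrite sub0r.
rewrite card_gt0 => /set0Pn [c]; rewrite inE => /eqP cu.
have c0 : c != 0 by move: u0; rewrite -cu expf_eq0.
by rewrite -cu nsqrt_sqr // (natrD _ 1 1) addrK.
Qed.

Lemma qcharM : {morph qchar : u v / u * v}.
Proof.
move=> u v; have [->|u0] := eqVneq u 0; first by rewrite mul0r qchar0 mul0r.
have [->|v0] := eqVneq v 0; first by rewrite mulr0 qchar0 mulr0.
have m1 : (- 1 == 1 :> F) = false.
  by apply: negbTE; rewrite eq_sym -addr_eq0 -(natrD _ 1 1).
rewrite !qcharE ?mulf_neq0 // exprMn.
by case/orP: (euler_pm1 u0) => /eqP ->; case/orP: (euler_pm1 v0) => /eqP ->;
  rewrite ?mulrNN ?mulr1 ?mul1r ?eqxx ?m1 ?mulrNN ?mulr1 ?mul1r ?eqxx.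
Qed.

Lemma qchar_sqr (c u : F) : c != 0 -> qchar (c ^+ 2 * u) = qchar u.
Proof. by move=> c0; rewrite qcharM /qchar nsqrt_sqr // (natrD _ 1 1) addrK mul1r. Qed.

Lemma qchar_unit (u : F) : u != 0 -> qchar u ^+ 2 = 1.
Proof. by move=> u0; rewrite qcharE //; case: ifP => _; rewrite ?sqrrN expr1n. Qed.

Lemma exists_nonsquare : exists2 nu : F, nu != 0 & nsqrt nu = 0%N.
Proof.
have [nu /andP [nu0 /eqP E]|H] := pickP (fun u : F => (u != 0) && (nsqrt u == 0%N)).
  by exists nu.
have : (#|[set u : F | u != 0%R]| <= #|[set u : F | (u != 0%R) && (0 < nsqrt u)%N]|)%N.
  apply/subset_leq_card/subsetP => u; rewrite !inE => u0; rewrite u0 /=.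
  by have := H u; rewrite u0 /= lt0n => ->.
have -> : [set u : F | u != 0] = [set~ 0] by apply/setP=> u; rewrite !inE.
rewrite card_nz_squares cardsC1.
have := card_finField_odd oddF; have := card_finField_gt1 F.
by move: (#|F|) => c; lia.
Qed.

Lemma card_affine (m k : F) (P : pred F) : m != 0 ->
  #|[set x | P (m * x + k)]| = #|[set y | P y]|.
Proof.
move=> m0; rewrite -[RHS](card_preimset _ (f := fun x => m * x + k)); last first.
  by move=> x y /addIr /(mulfI m0).
by apply: eq_card => x; rewrite !inE.
Qed.

(** Completing the square: 4 a (a x^2 - u x + b) = (2 a x - u)^2 - (u^2 - 4 a b). *)
Lemma card_quadratic (a b u : F) : a != 0 ->
  #|[set x | a * x ^+ 2 - u * x + b == 0]| = nsqrt (u ^+ 2 - 4%:R * a * b).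
Proof.
move=> a0.
have m0 : 2%:R * a != 0 by rewrite mulf_neq0.
rewrite /nsqrt -(card_affine (- u) (fun y => y ^+ 2 == u ^+ 2 - 4%:R * a * b) m0).
apply: eq_card => x; rewrite !inE.
have -> : ((2%:R * a * x - u) ^+ 2 == u ^+ 2 - 4%:R * a * b) =
          (4%:R * a * (a * x ^+ 2 - u * x + b) == 0).
  by rewrite -subr_eq0; congr (_ == 0); ring.
by rewrite !mulf_eq0 (negPf a0) (natrM _ 2 2) mulf_eq0 (negPf two_neq0).
Qed.

End QuadraticCharacter.

Definition additive_char (F : finFieldType) (psi : F -> algC) : Prop :=
  [/\ psi 0 = 1, {morph psi : x y / x + y >-> x * y} & exists x, psi x != 1].

Section AdditiveCharacter.

Variables (F : finFieldType) (psi : F -> algC).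
Hypothesis psiP : additive_char psi.

Lemma additive_char0 : psi 0 = 1. Proof. by case: psiP. Qed.
Lemma additive_charD : {morph psi : x y / x + y >-> x * y}. Proof. by case: psiP. Qed.

(** In characteristic p, [psi x] is a p-th root of unity. *)
Lemma additive_char_norm x : `|psi x| = 1.
Proof.
have [p p_pr pF] := finPcharP F.
have E n : psi (x *+ n) = psi x ^+ n.
  by elim: n => [|n IH]; rewrite ?mulr0n ?additive_char0 // mulrS additive_charD IH exprS.
have := E p; rewrite -mulr_natr pcharf0 // mulr0 additive_char0 => /esym/(congr1 Num.norm).
rewrite normrX normr1 => /eqP; rewrite pexpr_eq1 ?prime_gt0 //.
by move=> /eqP.
Qed.

Lemma additive_char_conj x : (psi x)^* = psi (- x).
Proof.
have H : psi x * psi (- x) = 1 by rewrite -additive_charD subrr additive_char0.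
have nz : psi x != 0 by rewrite -normr_eq0 additive_char_norm oner_eq0.
by apply: (mulfI nz); rewrite H -normCK additive_char_norm expr1n.
Qed.

Lemma sum_additive_char : \sum_x psi x = 0.
Proof.
have [_ _ [y yn]] := psiP.
have : psi y * (\sum_x psi x) = \sum_x psi x.
  rewrite mulr_sumr [RHS](reindex_inj (addrI y)).
  by apply: eq_bigr => x _; rewrite additive_charD.
move/eqP; rewrite -subr_eq0 -{2}[\sum_x _]mul1r -mulrBl mulf_eq0.
by rewrite subr_eq0 (negPf yn) => /eqP.
Qed.

Lemma sum_additive_char_scale a : \sum_x psi (a * x) = (#|F| * (a == 0%R))%N%:R.
Proof.
have [->|a0] := eqVneq a 0; rewrite ?muln1 ?muln0.
  under eq_bigr => x _ do rewrite mul0r additive_char0.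
  by rewrite sumr_const.
by rewrite -[RHS]sum_additive_char [RHS](reindex_inj (mulfI a0)).
Qed.

End AdditiveCharacter.

(** The additive group is abelian, so its irreducible characters are linear and there are |F| > 1 of
    them; the one of index 1 differs from the principal character ['chi_0]. *)
Lemma exists_additive_char (F : finFieldType) : exists psi : F -> algC, additive_char psi.
Proof.
pose G := fingroup.setT_group F.
have abG : fingroup.abelian G by exact: FinRing.zmod_abelian.
have lin : forall i : Iirr G, 'chi_i \is a linear_char by apply/char_abelianP.
have NG : (1 < Nirr G)%N.
  rewrite NirrE; move: abG; rewrite card_classes_abelian => /eqP ->.
  by rewrite cardsT card_finField_gt1.
pose i : Iirr G := Ordinal NG.
exists (fun x => 'chi_i x); split.
- exact: (lin_char1 (lin i)).
- by move=> x y; apply: (lin_charM (lin i)); rewrite inE.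
- have [x xn|H] := pickP (fun x : F => 'chi_i x != 1); first by exists x.
  have : 'chi_i = 'chi_0.
    apply/cfunP => x; rewrite irr0 cfun1E inE.
    by have := H x => /negbFE /eqP.
  by move/irr_inj/(congr1 val).
Qed.

(** * Kloosterman sums in quadratic extensions *)

Definition kloosterman (F : finFieldType) (psi : F -> algC) (a b : F) : algC :=
  \sum_(x | x != 0) psi (a * x + b / x).

Section KloostermanSquare.

Variables (F : finFieldType) (psi : F -> algC).
Hypotheses (oddF : odd #|F|) (psiP : additive_char psi).
Variables a b : F.
Hypotheses (a0 : a != 0) (b0 : b != 0).

Let two_neq0 : 2%:R != 0 :> F. Proof. exact: odd_card_two_neq0. Qed.

(* The terms of the square of the sum, with T = x + y and N = x y. *)
Definition kterm (T N : F) : algC := if N == 0 then 0 else psi (T * (a + b / N)).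

(** Pairs (x, y) are grouped by T = x + y and N = x y, since b / x + b / y = b T / N. The pairs with
    given T and N correspond to the roots of X^2 - T X + N. *)
Lemma kloosterman_sqr :
  kloosterman psi a b ^+ 2 =
  \sum_T \sum_N kterm T N *+ nsqrt (T ^+ 2 - 4%:R * N).
Proof.
have -> : kloosterman psi a b ^+ 2 = \sum_T \sum_x kterm T (x * (T - x)).
  rewrite exchange_big /= expr2 /kloosterman mulr_suml big_mkcond /=.
  apply: eq_bigr => x _; case: ifPn => [x0|/negPn/eqP ->]; last first.
    by rewrite big1 // => T _; rewrite mul0r /kterm eqxx.
  rewrite mulr_sumr (reindex_inj (addIr (- x))) /= big_mkcond /=.
  apply: eq_bigr => T _; rewrite /kterm mulf_eq0 (negPf x0) /=.
  case: eqVneq => //= y0; rewrite -additive_charD //; congr (psi _).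
  by field; rewrite x0 y0.
apply: eq_bigr => T _.
rewrite (partition_big (fun x : F => x * (T - x)) xpredT) //=.
apply: eq_bigr => N _.
rewrite (eq_bigr (fun=> kterm T N)); last by move=> x /eqP ->.
rewrite sumr_const; congr (_ *+ _).
have := card_quadratic oddF N T (oner_neq0 F); rewrite mulr1 => <-.
apply: eq_card => x; rewrite !inE unfold_in /= [LHS]eq_sym -[LHS]subr_eq0.
by congr (_ == 0); ring.
Qed.

(** Summing over T first kills every N except the one with a + b / N = 0. *)
Lemma sum_kterm : \sum_T \sum_N kterm T N = #|F|%:R.
Proof.
rewrite exchange_big /= (bigD1 (- b / a)) //= [X in _ + X]big1 ?addr0.
  rewrite -[RHS]sumr_const; apply: eq_bigr => T _.
  have /negPf E : - b / a != 0 by rewrite mulf_neq0 ?invr_eq0 ?oppr_eq0.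
  rewrite /kterm E; have -> : a + b / (- b / a) = 0 by field; rewrite a0 oppr_eq0 b0.
  by rewrite mulr0 additive_char0.
move=> N NE; rewrite /kterm; case: eqVneq => [_|N0]; first by rewrite big1.
under eq_bigr => T _ do rewrite mulrC.
rewrite sum_additive_char_scale //; case: eqVneq; rewrite ?muln0 // => E.
case/eqP: NE; have: N * (a + b / N) = 0 by rewrite E mulr0.
rewrite mulrDr mulrCA divff // mulr1 => /eqP; rewrite addr_eq0 => /eqP E1.
by rewrite -E1; field.
Qed.

(* The element x + y sqrt nu of the quadratic extension has trace 2 x and norm
   x^2 - nu y^2. *)
Lemma kloosterman_norm_form (nu : F) : nu != 0 -> nsqrt nu = 0%N ->
  \sum_x \sum_y kterm (2%:R * x) (x ^+ 2 - nu * y ^+ 2) =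
  (2 * #|F|)%:R - kloosterman psi a b ^+ 2.
Proof.
move=> nu0 nsq; apply/eqP; rewrite eq_sym subr_eq eq_sym; apply/eqP.
rewrite natrM -sum_kterm kloosterman_sqr.
have -> : \sum_x \sum_y kterm (2%:R * x) (x ^+ 2 - nu * y ^+ 2) =
  \sum_T \sum_N kterm T N *+ nsqrt ((4%:R * nu)^-1 * (T ^+ 2 - 4%:R * N)).
  rewrite [RHS](reindex_inj (mulfI two_neq0)); apply: eq_bigr => x _ /=.
  rewrite (partition_big (fun y : F => x ^+ 2 - nu * y ^+ 2) xpredT) //=.
  apply: eq_bigr => N _.
  rewrite (eq_bigr (fun=> kterm (2%:R * x) N)); last by move=> y /eqP ->.
  rewrite sumr_const; congr (_ *+ _).
  apply: eq_card => y; rewrite !inE unfold_in /=.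
  have -> : (4%:R * nu)^-1 * ((2%:R * x) ^+ 2 - 4%:R * N) = (x ^+ 2 - N) / nu.
    have four : 4%:R != 0 :> F by rewrite (natrM _ 2 2) mulf_neq0.
    by field; rewrite nu0 four.
  by apply/eqP/eqP => E; [rewrite -E | rewrite E]; field.
(* Termwise, with D = T^2 - 4 N, it remains that D and D / (4 nu) have two square roots in total:
   their [qchar] values are opposite because nu is not a square. *)
rewrite -big_split mulr_sumr; apply: eq_bigr => T _.
rewrite -big_split mulr_sumr; apply: eq_bigr => N _ /=.
have nsqE (u : F) : (nsqrt u)%:R = 1 + qchar u by rewrite /qchar addrC subrK.
have four : (4%:R * nu)^-1 = ((2%:R * nu)^-1) ^+ 2 * nu.
  by field; rewrite nu0 two_neq0 (natrM _ 2 2) mulf_neq0.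
rewrite -!(mulr_natr (kterm _ _)) !nsqE four -mulrA qchar_sqr //; last first.
  by rewrite invr_eq0 mulf_neq0.
rewrite qcharM // {1}/qchar nsq sub0r mulN1r; ring.
Qed.

End KloostermanSquare.

(** L = F[X] / (X^2 - nu) for a nonsquare nu, and theta is the class of X. A quadratic without roots
    is irreducible. *)
Lemma quadratic_extension (F : finFieldType) : odd #|F| ->
  exists (L : finFieldType) (iota : {rmorphism F -> L}) (theta : L) (nu : F),
  [/\ nu != 0, nsqrt nu = 0%N, theta ^+ 2 = iota nu & #|L| = (#|F| ^ 2)%N].
Proof.
move=> oddF; have [nu nu0 nsq] := exists_nonsquare oddF.
pose h : {poly F} := 'X^2 - nu%:P.
have hm : h \is monic by exact: monicXnsubC.
have sh : size h = 3%N by rewrite size_XnsubC.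
have hirr : irreducible_poly h.
  apply: cubic_irreducible; rewrite ?sh // => x; rewrite /root !hornerE.
  apply/negP; rewrite subr_eq0 => xnu; move: nsq; apply/eqP.
  by rewrite -lt0n card_gt0; apply/set0Pn; exists x; rewrite inE.
pose hI : monic_irreducible_poly h := (hirr, hm).
pose L : finFieldType := {poly %/ h with hI}.
pose Zm := GRing.isZmodMorphism.Build F L (qpolyC h) (@qpolyC_is_zmod_morphism F h).
pose Mm := GRing.isMonoidMorphism.Build F L (qpolyC h) (@qpolyC_is_monoid_morphism F h).
pose iota : {rmorphism F -> L} := HB.pack (qpolyC h : F -> L) Zm Mm.
exists L, iota, (in_qpoly h 'X), nu; split => //.
  have hQ : mk_monic h = h by rewrite /mk_monic sh hm.
  have E : in_qpoly h 'X ^+ 2 - in_qpoly h nu%:P = 0.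
    rewrite -rmorphXn -rmorphB /= -/h; apply/val_inj; rewrite /= hQ.
    by rewrite Pdiv.RingMonic.rmodpp.
  move/eqP: E; rewrite subr_eq0 => /eqP E; apply: (etrans E).
  by apply/val_inj; rewrite /= Pdiv.Ring.rmodp_small // hQ sh size_polyC; case: eqP.
by rewrite card_qfpoly sh.
Qed.

Lemma exprD_card (F : finFieldType) (L : fieldType) (iota : {rmorphism F -> L})
    (x y : L) : (x + y) ^+ #|F| = x ^+ #|F| + y ^+ #|F|.
Proof. exact/exprDn_pchar/(pchar_nat_card iota). Qed.

(** Euler's criterion gives theta^q = - theta, so z -> z^q is the conjugation of L over F, and [tr]
    is the trace. Writing b / z = (b / N) z^q, where N = z z^q, and using tr (z^q) = tr z, the
    argument of psi becomes (a + b / N) tr z, which is the norm form sum already evaluated. *)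
Lemma kloosterman_quadratic_extension (F : finFieldType) : odd #|F| ->
  exists (L : finFieldType) (iota : {rmorphism F -> L}) (tr : L -> F),
  [/\ #|L| = (#|F| ^ 2)%N,
      forall z, iota (tr z) = z + z ^+ #|F|,
      forall psi, additive_char psi -> additive_char (psi \o tr) &
      forall psi a b, additive_char psi -> a != 0 -> b != 0 ->
        kloosterman (psi \o tr) (iota a) (iota b) =
        (2 * #|F|)%:R - kloosterman psi a b ^+ 2].
Proof.
move=> oddF.
have [L [iota [theta [nu [nu0 nsq theta2 cardL]]]]] := quadratic_extension oddF.
pose h (x : F * F) := iota x.1 + iota x.2 * theta.
have hinj : injective h.
  move=> [x1 x2] [y1 y2]; rewrite /h /= => E.
  have E2 : iota (x1 - y1) = iota (y2 - x2) * theta.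
    by rewrite !rmorphB /= mulrBl; apply/eqP; rewrite subr_eq addrAC -subr_eq
      opprK; apply/eqP; rewrite E addrC.
  case: (eqVneq y2 x2) E2 => [->|ne E2].
    by rewrite subrr rmorph0 mul0r => /eqP; rewrite fmorph_eq0 subr_eq0 => /eqP ->.
  have d0 : y2 - x2 != 0 by rewrite subr_eq0.
  have : iota (((x1 - y1) / (y2 - x2)) ^+ 2) = iota nu.
    rewrite -theta2 rmorphXn fmorph_div /= E2 mulrAC divff ?mul1r //.
    by rewrite fmorph_eq0.
  move/fmorph_inj => Enu; move: nsq; apply: contra_eq => _.
  by rewrite -lt0n card_gt0; apply/set0Pn; exists ((x1 - y1) / (y2 - x2)); rewrite inE Enu.
have hbij : bijective h.
  by apply: inj_card_bij => //; rewrite card_prod cardL.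
have [g hK gK] := hbij.
have thetaq : theta ^+ #|F| = - theta.
  rewrite [in LHS](card_finField_odd oddF) exprS -mul2n exprM theta2 -rmorphXn /=.
  have /eqP -> : nu ^+ (#|F|.-1)./2 == - 1.
    by have := euler_pm1 oddF nu0; rewrite euler_criterion // nsq.
  by rewrite rmorphN rmorph1 mulrN1.
have iotaq c : iota c ^+ #|F| = iota c by rewrite -rmorphXn /= expf_card.
have hq x : h x ^+ #|F| = iota x.1 - iota x.2 * theta.
  by rewrite /h (exprD_card iota) exprMn !iotaq thetaq mulrN.
pose tr z := 2%:R * (g z).1.
have trh x : tr (h x) = 2%:R * x.1 by rewrite /tr hK.
have iotatr z : iota (tr z) = z + z ^+ #|F|.
  rewrite -(gK z) trh hq /h rmorphM /= rmorph_nat; ring.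
clearbody tr.
have trD : {morph tr : x y / x + y}.
  move=> x y; apply: (fmorph_inj iota).
  rewrite rmorphD /= !iotatr (exprD_card iota); ring.
have trZ c z : tr (iota c * z) = c * tr z.
  apply: (fmorph_inj iota); rewrite rmorphM /= !iotatr exprMn iotaq; ring.
have trq z : tr (z ^+ #|F|) = tr z.
  apply: (fmorph_inj iota); rewrite /= !iotatr -exprM mulnn -cardL expf_card addrC //.
exists L, iota, tr; split=> //.
  move=> psi psiP; split.
  - by rewrite /= -(mulr0 (iota 0)) trZ mul0r additive_char0.
  - by move=> x y; rewrite /= trD additive_charD.
  - have [_ _ [y yn]] := psiP; exists (h (y / 2%:R, 0)).
    by rewrite /= trh /= mulrC divfK // odd_card_two_neq0.
move=> psi a b psiP a0 b0.
rewrite -(kloosterman_norm_form oddF psiP a0 b0 nu0 nsq).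
rewrite pair_big /= /kloosterman (reindex h) /=; last by exists g => x _; auto.
rewrite big_mkcond /=; apply: eq_bigr => x _.
have nh : h x * h x ^+ #|F| = iota (x.1 ^+ 2 - nu * x.2 ^+ 2).
  by rewrite hq /h rmorphB rmorphXn rmorphM rmorphXn /= -theta2; ring.
have -> : (h x != 0) = (x.1 ^+ 2 - nu * x.2 ^+ 2 != 0).
  rewrite -[in RHS](fmorph_eq0 iota) -nh -exprS expf_eq0 //.
rewrite /kterm; case: eqVneq => //= N0.
have iN0 : iota (x.1 ^+ 2 - nu * x.2 ^+ 2) != 0 by rewrite fmorph_eq0.
have -> : iota b / h x = iota (b / (x.1 ^+ 2 - nu * x.2 ^+ 2)) * h x ^+ #|F|.
  rewrite fmorph_div -nh invfM /=; move: iN0; rewrite -nh mulf_eq0 negb_or => /andP [h0 hq0].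
  by rewrite -!mulrA mulVf // mulr1.
by rewrite trD !trZ trq trh; congr (psi _); ring.
Qed.

(** * Stepanov's method *)

(** P.['X^B] is an expansion in base X^B with digits of degree less than B, so the blocks of
    coefficients do not overlap. *)
Lemma horner_Xn_inj (K : fieldType) (B : nat) (P : {poly {poly K}}) :
  (forall i, (size (P`_i)%R <= B)%N) -> P.['X^B] = 0 -> P = 0.
Proof.
elim/poly_ind: P => // P c IH sP.
rewrite !hornerE => E.
have sc : (size c <= B)%N by have := sP 0%N; rewrite coefD coefMX coefC add0r.
have P0 : P.['X^B] = 0.
  apply/eqP/negP => /negP nz.
  have : (size (P.['X^B] * 'X^B)%R <= B)%N.
    by rewrite -[_ * _](addrK c) E sub0r size_polyN.
  by rewrite size_mulXn // -[leqRHS]addn0 leq_add2l leqn0 size_poly_eq0 (negPf nz).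
move: E; rewrite P0 mul0r add0r => ->; rewrite addr0 IH ?mul0r // => i.
by have := sP i.+1; rewrite coefD coefMX coefC addr0.
Qed.

(** Once a and d are made coprime, d^2 divides a^2, so d is constant and f is a constant times a^2.
    Separability then makes a coprime to itself, against f being nonconstant. *)
Lemma separable_mul_sqr_neq (K : fieldType) (f a d : {poly K}) :
  separable_poly f -> (1 < size f)%N -> a ^+ 2 = f * d ^+ 2 -> d = 0.
Proof.
move=> sepf sf E; apply/eqP/negP => /negP d0.
have G0 : gcdp a d != 0 by rewrite gcdp_eq0 (negPf d0) andbF.
have ca : coprimep (a %/ gcdp a d) (d %/ gcdp a d) by rewrite coprimep_div_gcd // d0 orbT.
have Ea := divpK (dvdp_gcdl a d); have Ed := divpK (dvdp_gcdr a d).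
set a' := a %/ _ in Ea ca; set d' := d %/ _ in Ed ca.
have E' : a' ^+ 2 = f * d' ^+ 2.
  by apply: (mulIf (expf_neq0 2 G0)); rewrite -exprMn Ea E -[RHS]mulrA -exprMn Ed.
have : size (d' ^+ 2) == 1%N.
  rewrite -coprimepp.
  have dv : d' ^+ 2 %| a' ^+ 2 by rewrite E' dvdp_mull.
  apply: (coprimep_dvdr dv).
  exact/coprimep_expl/coprimep_expr.
case/size_poly1P => c c0 Ec.
have : coprimep a' a'.
  have [sp _] := separable_polyP sepf; apply: (sp a' a').
  by rewrite -expr2 E' Ec mulrC mul_polyC dvdpZl.
rewrite coprimepp => /size_poly1P [k k0 Ek].
move: E'; rewrite Ec Ek => /(congr1 (size \o polyseq)) /=.
rewrite mulrC mul_polyC size_scale // -rmorphXn size_polyC => E1.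
by move: sf; rewrite -E1; case: (_ != 0).
Qed.

Section Stepanov.

Variables (L : finFieldType) (B g h : nat) (f : {poly L}).
Hypotheses (BE : B = h.*2.+1) (cardL : #|L| = (B ^ 2)%N).
Hypothesis pcharB : [pchar L].-nat B.
Hypotheses (monf : f \is monic) (sizef : size f = g.*2.+1).
Hypotheses (g0 : (0 < g)%N) (gh : (g <= h)%N).
Hypotheses (sepf : separable_poly f) (frobf : f ^+ B = f \Po 'X^B).

Let polyB (p q : {poly L}) : (p + q) ^+ B = p ^+ B + q ^+ B.
Proof.
by apply: exprDn_pchar; rewrite (eq_pnat _ (pchar_poly L)).
Qed.

Let polyBN (p : {poly L}) : (- p) ^+ B = - p ^+ B.
Proof. by rewrite exprNn -signr_odd BE /= odd_double /= expr1 mulN1r. Qed.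

Let size_sum_Xn n (u : 'I_n -> {poly L}) (k c : nat) :
  (forall j, (size (u j) <= k.+1)%N) ->
  (size (\sum_(j < n) (u j ^+ c * 'X^j))%R <= k * c + n)%N.
Proof.
move=> su; apply: (leq_trans (size_sum _ _ _)); apply/bigmax_leqP => j _.
apply: (leq_trans (size_polyMleq _ _)); rewrite size_polyXn addnS /=.
have := size_poly_exp_leq (u j) c.
have : ((size (u j)).-1 * c <= k * c)%N by rewrite leq_mul2r -subn1 leq_subLR (su j) orbT.
have := ltn_ord j; move: (size _) ((size _).-1 * c)%N (k * c)%N => s1 s2 s3; lia.
Qed.

(* Pigeonhole: the conditions are fewer than the coefficients, and they are
   additive in the coefficients because taking B-th powers is. *)
Lemma stepanov_relation :
  exists (u : 'I_(h + g).+1 -> {poly L}) (w : 'I_h.+1 -> {poly L}),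
  [/\ forall j, (size (u j) <= h.+1)%N, forall j, (size (w j) <= (h - g).+1)%N,
      \sum_j u j ^+ B * 'X^j = f ^+ h.+1 * \sum_j w j ^+ B * 'X^j &
      ~ ((forall j, u j = 0) /\ (forall j, w j = 0))].
Proof.
pose U := ({ffun 'I_(h + g).+1 -> {poly_(h.+1) L}} *
           {ffun 'I_h.+1 -> {poly_(h - g).+1 L}})%type.
(* Both sides get this same size bound: f^(h + 1) has degree 2 g (h + 1) = g B + g, which makes up
   for the smaller degrees and number of the [w]. *)
pose n := (h * B + (h + g).+1)%N.
pose Phi0 (x : U) : {poly L} :=
  \sum_j (x.1 j : {poly L}) ^+ B * 'X^j - f ^+ h.+1 * \sum_j (x.2 j : {poly L}) ^+ B * 'X^j.
pose Phi (x : U) : {poly_n L} := npolyp n (Phi0 x).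
have sPhi x : (size (Phi0 x) <= n)%N.
  apply: (leq_trans (size_polyD _ _)); rewrite geq_max size_polyN; apply/andP; split.
    by apply: size_sum_Xn => j; apply: size_npoly.
  apply: (leq_trans (size_polyMleq _ _)).
  have S2 : (size (\sum_j (x.2 j : {poly L}) ^+ B * 'X^j)%R <= (h - g) * B + h.+1)%N.
    by apply: size_sum_Xn => j; apply: size_npoly.
  have S1 := size_poly_exp_leq f h.+1; rewrite sizef /= in S1.
  rewrite /n; move: S1 S2; rewrite -addnn mulnBl; move: (size _) (size _) => s1 s2.
  have : (g * B <= h * B)%N by rewrite leq_mul2r gh orbT.
  rewrite BE -!addnn; lia.
have : ~~ injectiveb Phi.
  apply/negP => /injectiveP /leq_card.
  rewrite card_npoly card_prod !card_ffun !card_npoly !card_ord -!expnM -expnD.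
  rewrite leq_exp2l ?card_finField_gt1 // leqNgt => /negP; apply.
  (* The unknown coefficients number (h + 1)(B + 1), which is n + B - g. *)
  rewrite /n BE -!addnn; nia.
move/injectivePn => [x [y xy Exy]].
have E : Phi0 x = Phi0 y.
  by rewrite -(npolypK (sPhi x)) -(npolypK (sPhi y)) -/(Phi x) Exy.
exists (fun j => (x.1 j : {poly L}) - y.1 j), (fun j => (x.2 j : {poly L}) - y.2 j).
split.
- by move=> j; apply: (leq_trans (size_polyD _ _)); rewrite size_polyN geq_max !size_npoly.
- by move=> j; apply: (leq_trans (size_polyD _ _)); rewrite size_polyN geq_max !size_npoly.
- have dist m (a b : 'I_m -> {poly L}) :
    \sum_j (a j - b j) ^+ B * 'X^j = \sum_j a j ^+ B * 'X^j - \sum_j b j ^+ B * 'X^j.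
    by rewrite -sumrB; apply: eq_bigr => j _; rewrite polyB polyBN mulrBl.
  rewrite !dist; move: E; rewrite /Phi0.
  by move/eqP; rewrite subr_eq => /eqP ->; ring.
- move=> [H1 H2]; move/eqP: xy; apply.
  apply/eqP; rewrite -pair_eqE; apply/andP; split; apply/eqP/ffunP => j; apply/val_inj/eqP.
    by rewrite -subr_eq0; apply/eqP/H1.
  by rewrite -subr_eq0; apply/eqP/H2.
Qed.

(* H below is built so that H^B takes the values of a polynomial which vanishes by
   [stepanov_relation], because y^(B^2) = y on L: no derivatives are needed. *)
Lemma stepanov_bound :
  (#|[set y : L | f.[y] ^+ (#|L|.-1)./2 == - 1%R]| <= h + (h + g) * B)%N.
Proof.
have [u [w [su sw E nz]]] := stepanov_relation.
pose P n (v : 'I_n -> {poly L}) : {poly {poly L}} := \sum_j (v j)%:P * 'X^j.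
have coefP n (v : 'I_n -> {poly L}) i :
    (P n v)`_i = if insub i is Some j then v j else 0.
  rewrite /P coef_sum; case: insubP => [j _ <-|].
    rewrite (bigD1 j) //= big1 ?addr0; first by rewrite coefCM coefXn eqxx mulr1.
    by move=> k kj; rewrite coefCM coefXn eq_sym (negPf (_ : val k != j)) ?mulr0.
  rewrite -leqNgt => ni; rewrite big1 // => k _; rewrite coefCM coefXn.
  by rewrite gtn_eqF ?mulr0 // (leq_trans (ltn_ord k)).
have P_eq0 n (v : 'I_n -> {poly L}) : P n v = 0 -> forall j, v j = 0.
  by move=> P0 j; have := coefP n v j; rewrite P0 coef0 valK.
have sizeP n (v : 'I_n -> {poly L}) k : (forall j, (size (v j) <= k)%N) ->
    forall i, (size ((P n v)`_i)%R <= k)%N.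
  by move=> sv i; rewrite coefP; case: insubP => [j _ _|_]; rewrite ?size_poly0.
pose A := P _ u; pose D := P _ w.
pose H := A.['X^B] + f ^+ h.+1 * D.['X^B].
have hP n (v : 'I_n -> {poly L}) : (P n v).['X^B] = \sum_j v j * 'X^(B * j).
  by rewrite /P horner_sum; apply: eq_bigr => j _; rewrite !hornerE -exprM.
have sqsize (p : {poly {poly L}}) k : (forall i, (size (p`_i)%R <= k.+1)%N) ->
    forall i, (size ((p ^+ 2)`_i)%R <= k.*2.+1)%N.
  move=> sp i; rewrite expr2 coefM; apply: (leq_trans (size_sum _ _ _)).
  apply/bigmax_leqP => j _; apply: (leq_trans (size_polyMleq _ _)).
  have := sp j; have := sp (i - j)%N; rewrite -addnn; lia.
have H0 : H != 0.
  apply/negP => /eqP H0.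
  (* In two variables, A^2 - f(X) f(Y) D^2 vanishes at Y = X^B, because f^(2h + 2) = f f^B and f^B =
     f(X^B). Its coefficients in Y have degree at most 2 h < B in X, so it is zero, and its leading
     coefficients in Y would make f times a square a square. *)
  have HB : (A ^+ 2 - f%:P * map_poly polyC f * D ^+ 2).['X^B] = 0.
    rewrite !hornerE /=; have := H0; rewrite /H => /eqP; rewrite addr_eq0 => /eqP ->.
    rewrite sqrrN exprMn -exprM.
    have -> : (map_poly polyC f).['X^B] = f ^+ B by rewrite frobf.
    have -> : (h.+1 * 2 = B.+1)%N by rewrite BE; lia.
    by rewrite exprS expr2 mulrA subrr.
  have := horner_Xn_inj _ HB.
  have sAD i : (size ((A ^+ 2 - f%:P * map_poly polyC f * D ^+ 2)`_i)%R <= B)%N.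
    rewrite coefB; apply: (leq_trans (size_polyD _ _)); rewrite geq_max size_polyN.
    rewrite BE sqsize; last exact: sizeP.
    rewrite -mulrA coefCM; apply: (leq_trans (size_polyMleq _ _)).
    have : (size ((map_poly polyC f * D ^+ 2)`_i)%R <= (h - g).*2.+1)%N.
      rewrite coefM; apply: (leq_trans (size_sum _ _ _)); apply/bigmax_leqP => j _.
      rewrite coef_map mul_polyC; apply: (leq_trans (size_scale_leq _ _)).
      by apply: sqsize; apply: sizeP.
    by rewrite sizef -!addnn; move: (size _) => s; move: gh; clear; lia.
  move=> /(_ sAD) /eqP; rewrite subr_eq0 => /eqP AD.
  have monf2 : lead_coef (map_poly polyC f) = 1.
    by rewrite lead_coef_map_inj ?(monicP monf) //; exact: polyC_inj.
  have : lead_coef A ^+ 2 = f * lead_coef D ^+ 2.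
    by move: (congr1 lead_coef AD); rewrite !expr2 !lead_coefM monf2 lead_coefC mulr1.
  move/(separable_mul_sqr_neq sepf) => lD.
  have D0 : D = 0 by apply/eqP; rewrite -lead_coef_eq0 lD // sizef ltnS double_gt0.
  have A0 : A = 0 by move: AD; rewrite D0 expr0n mulr0 => /eqP; rewrite expf_eq0 => /eqP.
  by apply: nz; split; apply: P_eq0.
have sH : (size H <= (h + (h + g) * B).+1)%N.
  apply: (leq_trans (size_polyD _ _)); rewrite geq_max; apply/andP; split.
    rewrite hP; apply: (leq_trans (size_sum _ _ _)); apply/bigmax_leqP => j _.
    apply: (leq_trans (size_polyMleq _ _)); rewrite size_polyXn addnS /=.
    have := su j; have : (B * j <= B * (h + g))%N by rewrite leq_mul2l -ltnS ltn_ord orbT.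
    rewrite (mulnC B (h + g)); move: (size _) (B * j)%N => s1 s2; clear; lia.
  apply: (leq_trans (size_polyMleq _ _)).
  have S1 := size_poly_exp_leq f h.+1; rewrite sizef /= in S1.
  have S2 : (size (D.['X^B])%R <= (h - g).+1 + B * h)%N.
    rewrite hP; apply: (leq_trans (size_sum _ _ _)); apply/bigmax_leqP => j _.
    apply: (leq_trans (size_polyMleq _ _)); rewrite size_polyXn addnS /=.
    have := sw j; have : (B * j <= B * h)%N by rewrite leq_mul2l -ltnS ltn_ord orbT.
    move: (size _) (B * j)%N => s1 s2; clear; lia.
  move: S1 S2; move: (size _) (size _) => s1 s2; rewrite BE -!addnn; nia.
set S := [set y | _].
have rS : all (root H) (enum S).
  apply/allP => y; rewrite mem_enum inE => /eqP fy.
  have HB0 : H.[y] ^+ B = 0.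
    have pB (a b : L) : (a + b) ^+ B = a ^+ B + b ^+ B by exact: exprDn_pchar.
    have yP n (v : 'I_n -> {poly L}) :
        (P n v).['X^B].[y] ^+ B = (\sum_j v j ^+ B * 'X^j).[y].
      rewrite hP !horner_sum.
      rewrite (big_morph (fun p : L => p ^+ B) pB (_ : 0 ^+ B = 0)); last by rewrite expr0n BE.
      apply: eq_bigr => j _; rewrite !hornerE exprMn; congr (_ * _).
      by rewrite -exprM mulnAC mulnn -cardL exprM expf_card.
    rewrite /H !hornerE pB exprMn !yP E !hornerE -exprM.
    (* The two terms of H(y)^B cancel: f(y)^((h + 1) B) is f(y)^((|L| - 1)/2) f(y)^(h + 1), and the
       first factor is -1 on [S]. *)
    have -> : (h.+1 * B = (#|L|.-1)./2 + h.+1)%N.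
      rewrite cardL BE -!addnn; nia.
    by rewrite exprD fy mulN1r mulNr subrr.
  by move/eqP: HB0; rewrite expf_eq0 => /andP [_].
have := max_poly_roots H0 rS (enum_uniq _); rewrite -cardE => lt.
by rewrite -ltnS; apply: leq_trans sH.
Qed.

End Stepanov.

(** * Weil's bound for Kloosterman sums *)

(** The Kloosterman sums up the tower of quadratic extensions. The ring is left open so that the
    recursion can be moved from [algC] to the ordered field [algR]. *)
Fixpoint kseq (R : pzRingType) (q : nat) (k : R) (n : nat) : R :=
  if n is m.+1 then (2 * q ^ (2 ^ m))%:R - kseq q k m ^+ 2 else k.

(* With t_n = K_n^2 / q^(2^n), the recursion reads t_(n+1) = (t_n - 2)^2, which
   drives every t_0 > 4 to infinity. *)
Lemma kseq_bounded (R : archiRealFieldType) (q : nat) (k C : R) : (0 < q)%N ->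
  (forall n, kseq q k n ^+ 2 <= C * (q ^ (2 ^ n))%:R) ->
  k ^+ 2 <= (4 * q)%:R.
Proof.
move=> q0 H; rewrite leNgt; apply/negP => lt.
pose t n := kseq q k n ^+ 2 / (q ^ (2 ^ n))%:R.
have Q0 n : (0 : R) < (q ^ (2 ^ n))%:R by rewrite ltr0n expn_gt0 q0.
have tS n : t n.+1 = (t n - 2%:R) ^+ 2.
  rewrite /t; have -> : (q ^ (2 ^ n.+1) = q ^ (2 ^ n) * q ^ (2 ^ n))%N.
    by rewrite expnS mul2n -addnn expnD.
  by rewrite !natrM /= natrM; field; exact: lt0r_neq0.
pose e := t 0%N - 4%:R.
have e0 : 0 < e.
  by rewrite /e /t /= subr_gt0 ltr_pdivlMr ?Q0 // expn1 -natrM.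
(* Growth is much faster, but a linear bound suffices in an archimedean field: (2 + x)^2 >= 4 + 4
   x. *)
have grow n : 4%:R + n.+1%:R * e <= t n.
  elim: n => [|n IH]; first by rewrite /e; lra.
  rewrite tS; have : 0 <= n%:R * e by rewrite mulr_ge0 ?ler0n // ltW.
  by move: IH; rewrite -!natr1; nra.
have := archi_boundP (ltW (divr_gt0 (ltr_wpDl (normr_ge0 C) ltr01) e0)).
move: (Num.bound _) => m; rewrite ltr_pdivrMr // => mC.
have tC : t m.+1 <= C by rewrite /t ler_pdivrMr ?Q0 // H.
have := grow m.+1; have := ler_norm C; rewrite -[m.+2%:R]natr1 -[m.+1%:R]natr1.
move: (t _) (`|C|) (m%:R) e0 mC tC => tm nC x; clearbody e; lra.
Qed.

Lemma rmorph_kseq (R S : pzRingType) (phi : {rmorphism R -> S}) q k n :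
  phi (kseq q k n) = kseq q (phi k) n.
Proof. by elim: n => //= n IH; rewrite rmorphB rmorph_nat rmorphXn IH. Qed.

(** [tau] is the composite of the traces. Its invariance under z -> z^q is recorded because it makes
    [tau] vanish on every y^q - y. *)
Lemma kloosterman_tower (F : finFieldType) (n : nat) : odd #|F| ->
  exists (L : finFieldType) (iota : {rmorphism F -> L}) (tau : L -> F),
  [/\ #|L| = (#|F| ^ (2 ^ n))%N,
      {morph tau : x y / x + y} /\ (forall c z, tau (iota c * z) = c * tau z),
      forall z, tau (z ^+ #|F|) = tau z,
      forall psi, additive_char psi -> additive_char (psi \o tau) &
      forall psi a b, additive_char psi -> a != 0 -> b != 0 ->
        kloosterman (psi \o tau) (iota a) (iota b) =
        kseq #|F| (kloosterman psi a b) n].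
Proof.
move=> oddF; elim: n => [|n [L [iota [tau [cardL [tauD tauZ] tauq tauA tauK]]]]].
  by exists F, idfun, id; split=> // z; rewrite expf_card.
have oddL : odd #|L| by rewrite cardL oddX oddF orbT.
have [L' [iota' [tr [cardL' trE trA trK]]]] := kloosterman_quadratic_extension oddL.
have trD : {morph tr : x y / x + y}.
  move=> x y; apply: (fmorph_inj iota').
  rewrite rmorphD /= !trE (exprD_card iota'); ring.
have trZ c z : tr (iota' c * z) = c * tr z.
  apply: (fmorph_inj iota'); rewrite rmorphM /= !trE exprMn -rmorphXn /= expf_card; ring.
pose jota : {rmorphism F -> L'} := iota' \o iota.
exists L', jota, (tau \o tr); split.
- by rewrite cardL' cardL -expnM expnSr.
- split=> [x y|c z]; first by rewrite /= trD tauD.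
  by rewrite /= trZ tauZ.
- move=> z /=; rewrite -[RHS]tauq; congr (tau _).
  apply: (fmorph_inj iota'); rewrite rmorphXn /= !trE (exprD_card jota).
  by rewrite -!exprM mulnC.
- by move=> psi psiP; apply: (trA (psi \o tau)); apply: tauA.
- move=> psi a b psiP a0 b0.
  rewrite (trK (psi \o tau)) ?fmorph_eq0 //; last exact: tauA.
  by rewrite tauK // cardL.
Qed.

Lemma kloosterman_real (F : finFieldType) (psi : F -> algC) a b :
  additive_char psi -> kloosterman psi a b \is Num.real.
Proof.
move=> psiP; rewrite CrealE /kloosterman rmorph_sum /=; apply/eqP.
rewrite [RHS](reindex_inj oppr_inj) /=; apply: eq_big => x; first by rewrite oppr_eq0.
by move=> _; rewrite additive_char_conj // invrN !mulrN opprD.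
Qed.

(** * Points on the curve v^2 = (y^q - y)^2 - c *)

Section ArtinSchreier.

Variables (F L : finFieldType) (iota : {rmorphism F -> L}) (k : nat).
Hypotheses (oddF : odd #|F|) (cardL : #|L| = ((#|F| ^ k) ^ 2)%N).
Variable c : F.
Hypothesis c0 : c != 0.

Let q := #|F|.
Let B := (q ^ k)%N.
Let f : {poly L} := ('X^q - 'X) ^+ 2 - (iota c)%:P.

Let q2 : (2 < q)%N.
Proof. by have := card_finField_gt1 F; move: oddF; rewrite -/q; case: q => [|[|[|]]]. Qed.

Let size_u : size ('X^q - 'X : {poly L}) = q.+1.
Proof. by rewrite size_polyDl ?size_polyXn // size_polyN size_polyX ltnS ltnW. Qed.

Let size_u2 : size (('X^q - 'X : {poly L}) ^+ 2) = q.*2.+1.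
Proof.
have u0 : 'X^q - 'X != 0 :> {poly L} by rewrite -size_poly_eq0 size_u.
by rewrite expr2 size_mul // size_u addSn addnS /= addnn.
Qed.

Let size_f : size f = q.*2.+1.
Proof.
rewrite size_polyDl size_u2 // size_polyN (leq_ltn_trans (size_polyC_leq1 _)) //.
by rewrite ltnS double_gt0 ltnW // ltnW.
Qed.

Let monic_f : f \is monic.
Proof.
apply/monicP; rewrite lead_coefDl ?size_u2; last first.
  rewrite size_polyN (leq_ltn_trans (size_polyC_leq1 _)) //.
  by rewrite ltnS double_gt0 ltnW // ltnW.
rewrite expr2 lead_coefM lead_coefDl ?lead_coefXn ?mulr1 //.
by rewrite size_polyN size_polyX size_polyXn ltnS ltnW.
Qed.

Let horner_f y : f.[y] = (y ^+ q - y) ^+ 2 - iota c.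
Proof. by rewrite /f !hornerE. Qed.

(** As q = 0 in L, f' = -2 (X^q - X), while f is (X^q - X)^2 minus a nonzero constant: this is a
    Bezout relation. *)
Let sep_f : separable_poly f.
Proof.
rewrite separable_poly.unlock.
have L2 : 2%:R != 0 :> L by rewrite -(rmorph_nat iota) fmorph_eq0 odd_card_two_neq0.
have q0 : q%:R = 0 :> {poly L}.
  apply/eqP; rewrite -(rmorph_nat polyC) polyC_eq0.
  have [p p_pr pF] := finPcharP F.
  have pL : p \in [pchar L] by rewrite (rmorph_pchar iota).
  rewrite -(dvdn_pcharf pL) /q (card_finField_pchar pF) dvdn_exp //.
  rewrite lt0n; apply/eqP => E; move: (card_finField_gt1 F).
  by rewrite (card_finField_pchar pF) E.
have -> : f^`() = (- 2%:R)%:P * ('X^q - 'X).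
  rewrite /f expr2 derivB derivC subr0 derivM derivB derivXn derivX.
  rewrite -(mulr_natl 'X^_ q) q0 mul0r polyCN polyC_natr; ring.
rewrite mul_polyC coprimepZr ?oppr_eq0 //.
rewrite coprimep_sym; apply/Bezout_eq1_coprimepP.
exists ((iota c)^-1 *: ('X^q - 'X), - (iota c)^-1%:P).
have ic : iota c != 0 by rewrite fmorph_eq0.
have E : (iota c)^-1%:P * (iota c)%:P = 1 by rewrite -polyCM mulVf.
by rewrite -[RHS]E /= /f -mul_polyC; ring.
Qed.

Let pcharB : [pchar L].-nat B.
Proof. by rewrite pnatX (pchar_nat_card iota). Qed.

(** The coefficients of f come from F, so raising to the power B, a power of q, fixes them. *)
Let frob_f : f ^+ B = f \Po 'X^B.
Proof.
have oddB : odd B by rewrite oddX oddF orbT.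
have pB (x y : {poly L}) : (x + y) ^+ B = x ^+ B + y ^+ B.
  by apply: exprDn_pchar; rewrite (eq_pnat _ (pchar_poly L)).
have pN (x : {poly L}) : (- x) ^+ B = - x ^+ B.
  by rewrite exprNn -signr_odd oddB expr1 mulN1r.
have iB : iota c ^+ B = iota c.
  rewrite /B; elim: k => [|n IH]; first by rewrite expr1.
  by rewrite expnSr exprM IH -rmorphXn /= expf_card.
rewrite /f pB pN -exprM mulnC exprM pB pN -rmorphXn /= iB.
by rewrite comp_polyB comp_polyC !rmorphXn /= comp_polyB !rmorphXn /= comp_polyX -!exprM (mulnC q).
Qed.

Lemma artin_schreier_sum :
  (#|L| <= \sum_(y : L) nsqrt ((y ^+ q - y) ^+ 2 - iota c)%R + 2 * q * B + 2 * q)%N.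
Proof.
have oddL : odd #|L| by rewrite cardL !oddX oddF !orbT.
have oddB : odd B by rewrite oddX oddF orbT.
have BE : B = (B./2).*2.+1 by rewrite -[LHS]odd_double_half oddB.
(* Stepanov's bound needs q <= h, where B = 2 h + 1. Otherwise B < 2 q, and the term 2 q B alone
   exceeds |L| = B^2. *)
case: (leqP q B./2) => [qB|]; last first.
  move=> lt; rewrite cardL -/B; move: lt BE; move: (B./2) => h; nia.
have H := stepanov_bound BE cardL pcharB monic_f size_f (ltnW (ltnW q2)) qB sep_f frob_f.
(* Each y should contribute two points; nonsquare values of f miss both and roots of f miss one. *)
have pt y : (2 <= nsqrt f.[y] + 2 * (f.[y] ^+ (#|L|.-1)./2 == - 1%R) + (root f y))%N.
  rewrite /root; case: (eqVneq f.[y] 0) => [->|f0]; first by rewrite (nsqrt0 L) /= addnAC.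
  have := euler_pm1 oddL f0; rewrite euler_criterion //.
  case/orP => [|->]; last by rewrite muln1 addnAC addn2.
  rewrite card_gt0 => /set0Pn [s]; rewrite inE => /eqP sE.
  by rewrite -sE nsqrt_sqr ?oddL //; move: f0; rewrite -sE expf_eq0.
have rt : (\sum_y root f y <= 2 * q)%N.
  rewrite -big_mkcond /= sum1_card cardE.
  have := @max_poly_roots L f (enum (root f)); rewrite size_f -mul2n ltnS; apply.
  - by rewrite monic_neq0.
  - by apply/allP => y; rewrite mem_enum.
  - exact: enum_uniq.
have ml : (\sum_(y : L) 2 <= \sum_(y : L) (nsqrt f.[y] +
    2 * (f.[y] ^+ (#|L|.-1)./2 == - 1%R) + (root f y)))%N.
  by apply: leq_sum => y _; exact: pt.
have E2 : (\sum_(y : L) (f.[y] ^+ (#|L|.-1)./2 == - 1%R) =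
    #|[set y | f.[y] ^+ (#|L|.-1)./2 == - 1%R]|)%N.
  rewrite -sum1_card [RHS]big_mkcond /=.
  by apply: eq_bigr => y _; rewrite inE; case: (_ == _).
move: ml; rewrite sum_nat_const !big_split /= E2 big1_eq.
under eq_bigr => y _ do rewrite horner_f.
(* Twice Stepanov's bound is 2 h (B + 1) + 2 q B = B^2 - 1 + 2 q B, so about half of the total 2 B^2
   survives. *)
move: H rt; move: (#|[set _ | _]|) (\sum_y _)%N (\sum_y _)%N => s1 s2 s3.
rewrite cardL -/B; move: (B./2) BE => h ->; nia.
Qed.

End ArtinSchreier.

(** By orthogonality the sum over all c, zero included, is q times the number of x <> 0 with tau (a
    x + b / x) = 0. This is at least the number of pairs (x, y) with y^q - y = a x + b / x: each x
    has at most q such y, and none unless the trace vanishes. Solving for x instead gives the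
    discriminant (y^q - y)^2 - 4 a b. The term c = 0 is |L| - 1, which cancels the main term. *)
Lemma kloosterman_sum_lower (F L : finFieldType) (iota : {rmorphism F -> L})
    (tau : L -> F) (k : nat) (psi : F -> algC) (a b : F) :
  odd #|F| -> #|L| = ((#|F| ^ k) ^ 2)%N ->
  {morph tau : x y / x + y} -> (forall c z, tau (iota c * z) = c * tau z) ->
  (forall z, tau (z ^+ #|F|) = tau z) ->
  additive_char psi -> a != 0 -> b != 0 ->
  - (2 * #|F| * #|F| ^ k + 2 * #|F|)%:R <=
  \sum_(c | c != 0) kloosterman (psi \o tau) (iota (c * a)) (iota (c * b)).
Proof.
move=> oddF cardL tauD tauZ tauq psiP a0 b0; set q := #|F|.
have tauN x : tau (- x) = - tau x by rewrite -mulN1r -(rmorphN1 iota) tauZ mulN1r.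
have oddL : odd #|L| by rewrite cardL !oddX oddF !orbT.
pose z x := iota a * x + iota b / x.
pose Z := (\sum_(x : L | x != 0%R) (tau (z x) == 0%R))%N.
have S1 : \sum_c kloosterman (psi \o tau) (iota (c * a)) (iota (c * b)) = (q * Z)%:R.
  rewrite exchange_big /= natrM natr_sum mulr_sumr; apply: eq_bigr => x _.
  rewrite -natrM -(sum_additive_char_scale psiP); apply: eq_bigr => c _ /=.
  by rewrite [tau (z x) * c]mulrC -tauZ /z; congr (psi (tau _)); rewrite !rmorphM /=; ring.
have Zle : (\sum_(y : L) nsqrt ((y ^+ q - y) ^+ 2 - iota (4%:R * a * b))%R <= q * Z)%N.
  have ia0 : iota a != 0 by rewrite fmorph_eq0.
  rewrite (eq_bigr (fun y => \sum_(x : L) (iota a * x ^+ 2 - (y ^+ q - y) * x + iota b == 0)%R)%N); last first.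
    move=> y _; rewrite !rmorphM rmorph_nat -card_quadratic // -sum1_card big_mkcond /=.
    by apply: eq_bigr => x _; rewrite inE; case: (_ == _).
  rewrite exchange_big /= (bigD1 0%R) //= big1 ?add0n; last first.
    by move=> y _; rewrite expr0n mulr0 mulr0 subrr add0r fmorph_eq0 (negPf b0).
  rewrite big_distrr /=; apply: leq_sum => x x0.
  have E y : (iota a * x ^+ 2 - (y ^+ q - y) * x + iota b == 0) = (y ^+ q - y == z x).
    have -> : iota a * x ^+ 2 - (y ^+ q - y) * x + iota b = x * (z x - (y ^+ q - y)).
      by rewrite /z; field.
    by rewrite mulf_eq0 (negPf x0) subr_eq0 eq_sym.
  under eq_bigr => y _ do rewrite E.
  case: (boolP [exists y, y ^+ q - y == z x]) => [/existsP [y0 /eqP Ey0]|/existsPn ne]; last first.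
    by rewrite big1 // => y _; rewrite (negPf (ne y)).
  have -> : tau (z x) == 0 by rewrite -Ey0 tauD tauN tauq subrr.
  rewrite muln1 -big_mkcond /= sum1_card cardE.
  have sz : size ('X^q - 'X - (z x)%:P) = q.+1.
    have q1 : (1 < q)%N := card_finField_gt1 F.
    rewrite -addrA size_polyDl ?size_polyXn // -opprD size_polyN.
    by rewrite size_XaddC.
  have := @max_poly_roots L ('X^q - 'X - (z x)%:P) (enum [pred y | y ^+ q - y == z x]).
  rewrite sz ltnS; apply.
  - by rewrite -size_poly_eq0 sz.
  - by apply/allP => y; rewrite mem_enum inE /root !hornerE subr_eq0.
  - exact: enum_uniq.
have c0 : 4%:R * a * b != 0.
  by rewrite !mulf_neq0 // (natrM _ 2 2) mulf_neq0 // odd_card_two_neq0.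
have AS := artin_schreier_sum iota oddF cardL c0.
move: S1; rewrite (bigD1 0) //=; move/(canRL (addKr _)) => ->.
have -> : kloosterman (psi \o tau) (iota (0 * a)) (iota (0 * b)) = #|L|.-1%:R.
  rewrite /kloosterman (eq_bigr (fun=> 1)); last first.
    by move=> x _; rewrite !mul0r rmorph0 !mul0r addr0 /= -(mulr0 (iota 0)) tauZ mul0r additive_char0.
  by rewrite sumr_const -(cardC1 (0 : L)); congr (_%:R); apply: eq_card => x; rewrite !inE.
rewrite lerNl opprD opprK lerBlDr -natrD ler_nat -/q.
apply: (leq_trans (leq_pred _)); apply: (leq_trans AS); rewrite -/q.
by rewrite -addnA [leqRHS]addnC leq_add2r.
Qed.

(* Otherwise the tower of quadratic extensions would produce Kloosterman sums
   that are too negative for [kloosterman_sum_lower]. *)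
Theorem kloosterman_bound (F : finFieldType) (psi : F -> algC) (a b : F) :
  odd #|F| -> additive_char psi -> a != 0 -> b != 0 ->
  `|kloosterman psi a b| ^+ 2 <= (4 * #|F|)%:R.
Proof.
move=> oddF psiP a0 b0; set q := #|F|.
have Kreal x y : kloosterman psi x y \is Num.real by apply: kloosterman_real.
have q1 : (0 < q)%N := ltnW (card_finField_gt1 F).
rewrite real_normK //.
pose r := in_algR (Kreal a b).
suff : r ^+ 2 <= (4 * q)%:R.
  by rewrite -[_ <= _]/(algRval _ <= algRval _) rmorphXn rmorph_nat.
(* One level higher, where the field has B^2 elements, the lower bound -(2 q B + 2 q) meets the
   upper bound 2 q B - K_n^2; hence K_n^2 <= 4 q B + 2 q <= 6 q B. *)
apply: (@kseq_bounded _ q r (6 * q)%:R) => // n.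
rewrite -[_ <= _]/(algRval _ <= algRval _) rmorphXn rmorphM !rmorph_nat /= rmorph_kseq /= -natrM.
have [L [iota [tau [cardL [tauD tauZ] tauq tauA tauK]]]] := kloosterman_tower n.+1 oddF.
have cardL2 : #|L| = ((#|F| ^ (2 ^ n)) ^ 2)%N by rewrite cardL -expnM expnSr.
have lower := kloosterman_sum_lower oddF cardL2 tauD tauZ tauq psiP a0 b0.
rewrite -/q in lower; set B := (q ^ 2 ^ n)%N in lower *.
have sqge0 c : 0 <= kseq q (kloosterman psi (c * a) (c * b)) n ^+ 2.
  have -> : kloosterman psi (c * a) (c * b) = algRval (in_algR (Kreal (c * a) (c * b))) by [].
  by rewrite -rmorph_kseq -rmorphXn; apply: (sqr_ge0 (kseq q (in_algR (Kreal (c * a) (c * b))) n)).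
have term c : c != 0 ->
    kloosterman (psi \o tau) (iota (c * a)) (iota (c * b)) =
    (2 * B)%:R - kseq q (kloosterman psi (c * a) (c * b)) n ^+ 2.
  by move=> c0; rewrite tauK // mulf_neq0.
(* Every term is 2 B minus a square; only the square at c = 1 is kept. *)
have upper : \sum_(c | c != 0) kloosterman (psi \o tau) (iota (c * a)) (iota (c * b)) <=
    (q * (2 * B))%:R - kseq q (kloosterman psi a b) n ^+ 2.
  rewrite (bigD1 1) ?oner_neq0 //= term ?oner_neq0 // !mul1r addrAC lerD2r.
  rewrite -lerBrDl.
  apply: (@le_trans _ _ (\sum_(c : F | (c != 0) && (c != 1)) (2 * B)%:R)).
    by apply: ler_sum => c /andP [c0 _]; rewrite term // lerBlDr lerDl.
  rewrite lerBrDl.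
  have -> : (2 * B)%:R + \sum_(c : F | (c != 0) && (c != 1)) (2 * B)%:R =
     \sum_(c : F | c != 0) (2 * B)%:R :> algC.
    by rewrite [RHS](bigD1 1) ?oner_neq0.
  rewrite sumr_const -mulrnA ler_nat [leqRHS]mulnC leq_mul2l; apply/orP; right.
  exact: max_card.
have := le_trans lower upper.
rewrite lerBrDr addrC lerBlDr -natrD => /le_trans; apply; rewrite ler_nat.
have : (0 < B)%N by rewrite expn_gt0 q1.
clearbody B; clear -q1; clearbody q; nia.
Qed.

(** * Gauss and Salie sums *)

Section GaussSalie.

Variables (F : finFieldType) (psi : F -> algC).
Hypotheses (oddF : odd #|F|) (psiP : additive_char psi).

Let two_neq0 : 2%:R != 0 :> F. Proof. exact: odd_card_two_neq0. Qed.
Let four_neq0 : 4%:R != 0 :> F. Proof. by rewrite (natrM _ 2 2) mulf_neq0. Qed.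

Definition gauss (s : F) : algC := \sum_x psi (s * x ^+ 2).

Lemma gauss_qchar s : s != 0 -> gauss s = \sum_u qchar u * psi (s * u).
Proof.
move=> s0; rewrite /gauss (sum_sqr (fun u => psi (s * u))).
have -> : \sum_u qchar u * psi (s * u) =
    \sum_u (psi (s * u) *+ nsqrt u - psi (s * u)).
  by apply: eq_bigr => u _; rewrite /qchar mulrBl mul1r mulr_natl.
by rewrite sumrB sum_additive_char_scale // (negPf s0) muln0 subr0.
Qed.

Lemma gaussE s : s != 0 -> gauss s = qchar s * gauss 1.
Proof.
move=> s0; rewrite !gauss_qchar ?oner_neq0 //.
rewrite mulr_sumr [RHS](reindex_inj (mulfI s0)); apply: eq_bigr => u _ /=.
by rewrite qcharM // mulrA mulrA -expr2 qchar_unit // mul1r mul1r.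
Qed.

(** Substituting x = y + h leaves a sum over y that is linear in the exponent and vanishes unless h
    = 0. *)
Lemma gauss_norm s : s != 0 -> `|gauss s| ^+ 2 = #|F|%:R.
Proof.
move=> s0; rewrite normCK /gauss rmorph_sum /= mulr_sumr.
transitivity (\sum_h \sum_y psi (s * h ^+ 2) * psi (s * 2%:R * h * y)).
  rewrite exchange_big /=; apply: eq_bigr => y _.
  rewrite mulr_suml [LHS](reindex_inj (addrI y)); apply: eq_bigr => h _ /=.
  rewrite additive_char_conj // -!additive_charD //; congr (psi _); ring.
rewrite (bigD1 0) //= [X in _ + X]big1 ?addr0.
  under eq_bigr => y _ do rewrite expr0n !mulr0 mul0r additive_char0 // mulr1.
  by rewrite sumr_const.
move=> h h0; rewrite -mulr_sumr sum_additive_char_scale //.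
by rewrite !mulf_eq0 (negPf s0) (negPf h0) (negPf two_neq0) muln0 mulr0.
Qed.

Lemma gauss_linear s t : s != 0 ->
  \sum_x psi (s * x ^+ 2 + t * x) = psi (- (t ^+ 2 / 4%:R) / s) * gauss s.
Proof.
move=> s0; rewrite /gauss mulr_sumr [RHS](reindex_inj (addIr (t / (2%:R * s)))).
apply: eq_bigr => x _; rewrite -additive_charD //; congr (psi _).
by field; rewrite s0 four_neq0 two_neq0.
Qed.

Definition salie (a b : F) : algC := \sum_(x | x != 0) qchar x * psi (a * x + b / x).

Lemma salie_scale (c a b : F) : c != 0 ->
  salie a b = qchar c * salie (a * c) (b / c).
Proof.
move=> c0; rewrite /salie (reindex_inj (mulfI c0)) /= mulr_sumr.
apply: eq_big => x; first by rewrite mulf_eq0 (negPf c0).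
move=> _; rewrite qcharM // mulrA; congr (_ * psi _).
by rewrite invfM !mulrA.
Qed.

(* Writing qchar x * psi (- 1 / x) as a quadratic exponential sum linearizes
   the sum over x. *)
Lemma salie_m1 (a : F) : a != 0 ->
  gauss 1 * salie a (- 1) = #|F|%:R * \sum_(z | z ^+ 2 == - a) psi (2%:R * z).
Proof.
move=> a0; rewrite /salie mulr_sumr.
transitivity (\sum_(x | x != 0) \sum_z psi (2%:R * z) * psi ((z ^+ 2 + a) * x)).
  apply: eq_bigr => x x0; rewrite mulrA (mulrC (gauss 1)) -gaussE //.
  transitivity (psi (a * x) * (\sum_z psi (x * z ^+ 2 + 2%:R * z))).
    rewrite gauss_linear // [RHS]mulrA -additive_charD // [RHS]mulrC.
    congr (_ * psi _); congr (_ + _ / _); congr (- _).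
    by rewrite expr2 -natrM divff.
  rewrite mulr_sumr; apply: eq_bigr => z _; rewrite -!additive_charD //.
  by congr (psi _); ring.
rewrite exchange_big /=.
transitivity (\sum_z psi (2%:R * z) * ((#|F| * (z ^+ 2 + a == 0)%R)%N%:R - 1)).
  apply: eq_bigr => z _; rewrite -mulr_sumr; congr (_ * _).
  rewrite -(sum_additive_char_scale psiP) [X in _ = X - 1](bigD1 0) //=.
  by rewrite mulr0 additive_char0 // addrC addrK.
rewrite (eq_bigr (fun z => psi (2%:R * z) * (#|F| * (z ^+ 2 + a == 0)%R)%N%:R -
  psi (2%:R * z))) => [|z _]; last by rewrite mulrBr mulr1.
rewrite sumrB sum_additive_char_scale // (negPf two_neq0) muln0 subr0.
rewrite mulr_sumr [RHS]big_mkcond; apply: eq_bigr => z _ /=.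
rewrite addr_eq0; case: eqP => _; rewrite ?muln1 ?muln0 ?mulr0 //.
by rewrite mulrC.
Qed.

Lemma nsqrt_le2 (u : F) : (nsqrt u <= 2)%N.
Proof.
have [->|u0] := eqVneq u 0; first by rewrite nsqrt0.
case: (posnP (nsqrt u)) => [-> //|]; rewrite card_gt0 => /set0Pn [c].
by rewrite inE => /eqP cu; rewrite -cu nsqrt_sqr //; move: u0; rewrite -cu expf_eq0.
Qed.

(** Rescaling by - b reduces to b = -1, where the evaluation has at most two terms of modulus 1 and
    |gauss 1|^2 = q. For b = 0 the sum is a Gauss sum. *)
Lemma salie_bound (a b : F) : a != 0 -> `|salie a b| ^+ 2 <= (4 * #|F|)%:R.
Proof.
move=> a0.
have [->|b0] := eqVneq b 0.
  have -> : salie a 0 = gauss a.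
    rewrite gauss_qchar // [RHS](bigD1 0) //= qchar0 // mul0r add0r.
    by apply: eq_bigr => x _; rewrite mul0r addr0.
  by rewrite gauss_norm // ler_nat leq_pmull.
have nb0 : - b != 0 by rewrite oppr_eq0.
rewrite (salie_scale a b nb0) normrM exprMn -normrX qchar_unit // normr1 mul1r.
have -> : b / - b = - 1 by rewrite invrN mulrN divff.
have ab0 : a * - b != 0 by rewrite mulf_neq0.
have := congr1 (fun z => `|z| ^+ 2) (salie_m1 ab0).
rewrite /= !normrM !exprMn gauss_norm ?oner_neq0 // normr_nat.
have q0 : (0 : algC) < #|F|%:R by rewrite ltr0n ltnW // card_finField_gt1.
move=> E; rewrite -(ler_pM2l q0) E natrM [leRHS]mulrCA -expr2 [leRHS]mulrC.
rewrite ler_pM2l ?exprn_gt0 //.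
have -> : 4%:R = 2%:R ^+ 2 :> algC by rewrite -natrX.
rewrite lerXn2r ?nnegrE ?ler0n //.
apply: (le_trans (ler_norm_sum _ _ _)).
rewrite (eq_bigr (fun=> 1)) => [|z _]; last exact: additive_char_norm.
rewrite sumr_const ler_nat; apply: leq_trans (nsqrt_le2 (- (a * - b))).
by rewrite /nsqrt cardsE.
Qed.

(** Only the parity of d matters: a Salie sum if it is odd, a Kloosterman sum if it is even. The
    case b = 0 is allowed because b will be a multiple of [sqnorm xi], which may vanish. *)
Lemma twisted_kloosterman_bound (d : nat) (a b : F) : a != 0 ->
  `|\sum_(x | x != 0) qchar x ^+ d * psi (a * x + b / x)| ^+ 2 <= (4 * #|F|)%:R.
Proof.
move=> a0.
have q1 : (0 < #|F|)%N := ltnW (card_finField_gt1 F).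
have E (x : F) : x != 0 -> qchar x ^+ d = qchar x ^+ odd d.
  move=> x0; rewrite -[in LHS](odd_double_half d) exprD -mul2n exprM.
  by rewrite (qchar_unit oddF x0) expr1n mulr1.
rewrite (eq_bigr (fun x => qchar x ^+ odd d * psi (a * x + b / x))); last first.
  by move=> x x0; rewrite E.
case: (odd d); first exact: salie_bound.
rewrite (eq_bigr (fun x => psi (a * x + b / x))) => [|x _]; last by rewrite mul1r.
have [->|b0] := eqVneq b 0; last exact: kloosterman_bound.
have := sum_additive_char_scale psiP a; rewrite (negPf a0) muln0.
rewrite (bigD1 0) //= mulr0 additive_char0 // => /eqP; rewrite addrC addr_eq0 => /eqP S.
rewrite (eq_bigr (fun x => psi (a * x))) => [|x _]; last by rewrite mul0r addr0.
by rewrite S normrN normr1 expr1n ler1n muln_gt0.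
Qed.

End GaussSalie.

(** * Fourier transform of spheres *)

(** A form without square roots. In the induction the cross term is bounded by the inequality of
    means applied to c y B and c A z, whose product bounds x^2 S^2. *)
Lemma Cauchy_Schwarz_sum (R : realFieldType) (I : Type) (r : seq I)
    (D a b : I -> R) (c : R) :
  0 <= c -> (forall i, 0 <= a i) -> (forall i, 0 <= b i) ->
  (forall i, D i ^+ 2 <= c * a i * b i) ->
  (\sum_(i <- r) D i) ^+ 2 <= c * (\sum_(i <- r) a i) * (\sum_(i <- r) b i).
Proof.
move=> c0 a0 b0 H; elim: r => [|i r IH]; first by rewrite !big_nil expr0n /= mulr0.
rewrite !big_cons; move: IH (H i) (a0 i) (b0 i).
have : 0 <= \sum_(j <- r) a j by apply: sumr_ge0.
have : 0 <= \sum_(j <- r) b j by apply: sumr_ge0.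
move: (\sum_(j <- r) D j) (\sum_(j <- r) a j) (\sum_(j <- r) b j) (D i) (a i) (b i).
move=> S A B x y z B0 A0 SAB xyz y0 z0.
suff : 2%:R * (x * S) <= c * (y * B + A * z) by nra.
apply: le_trans (ler_norm _) _.
have pB : 0 <= c * y * B by rewrite !mulr_ge0.
have pA : 0 <= c * A * z by rewrite !mulr_ge0.
rewrite -(ler_pXn2r (n := 2)) ?nnegrE //; last by rewrite mulr_ge0 // addr_ge0 // mulr_ge0.
rewrite real_normK ?num_real //.
have : (x ^+ 2) * S ^+ 2 <= (c * y * z) * (c * A * B).
  by apply: ler_pM; rewrite ?sqr_ge0.
have : 0 <= (c * y * B - c * A * z) ^+ 2 by apply: sqr_ge0.
nra.
Qed.

Section Fourier.

Variables (F : finFieldType) (psi : F -> algC).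
Hypotheses (oddF : odd #|F|) (psiP : additive_char psi).
Variable d : nat.
Local Notation V := 'rV[F]_d.
Local Notation q := #|F|.

Definition dotp (u v : V) : F := \sum_j u ord0 j * v ord0 j.

Lemma dotpBr u v w : dotp u (v - w) = dotp u v - dotp u w.
Proof. by rewrite /dotp -sumrB; apply: eq_bigr => j _; rewrite !mxE mulrBr. Qed.

Lemma additive_char_sum (I : finType) (E : I -> F) :
  psi (\sum_i E i) = \prod_i psi (E i).
Proof.
by apply: (big_morph psi); [exact: additive_charD | exact: additive_char0].
Qed.

Lemma sum_rV_prod (g : 'I_d -> F -> algC) :
  \sum_(v : V) \prod_j g j (v ord0 j) = \prod_j \sum_x g j x.
Proof.
rewrite bigA_distr_bigA /=.
rewrite (reindex (fun h : {ffun 'I_d -> F} => \row_j h j)) /=; last first.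
  exists (fun v : V => [ffun j => v ord0 j]) => [h _|v _].
    by apply/ffunP => j; rewrite ffunE mxE.
  by apply/rowP => j; rewrite mxE ffunE.
by apply: eq_bigr => h _; apply: eq_bigr => j _; rewrite mxE.
Qed.

Lemma sum_dotp (v : V) : \sum_xi psi (dotp xi v) = (q ^ d * (v == 0)%R)%N%:R.
Proof.
rewrite (eq_bigr (fun xi : V => \prod_j psi (v ord0 j * xi ord0 j))); last first.
  move=> xi _; rewrite -additive_char_sum; congr (psi _).
  by apply: eq_bigr => j _; rewrite mulrC.
rewrite (sum_rV_prod (fun j x => psi (v ord0 j * x))).
have [->|v0] := eqVneq v 0.
  rewrite muln1 natrX -[d in RHS]card_ord -prodr_const; apply: eq_bigr => j _.
  by rewrite sum_additive_char_scale // mxE eqxx muln1.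
have /rV0Pn [j vj] := v0.
by rewrite (bigD1 j) //= sum_additive_char_scale // (negPf vj) !muln0 mul0r.
Qed.

(** As a character sum its Fourier transform factors over the coordinates; leaving out s = 0
    subtracts the density of the sphere. *)
Definition sphere_kernel (lam : F) (v : V) : algC :=
  \sum_(s | s != 0) psi (s * (sqnorm v - lam)).

Lemma sphere_kernelE lam v :
  sphere_kernel lam v = (q * (sqnorm v == lam)%R)%N%:R - 1.
Proof.
rewrite -subr_eq0 -(sum_additive_char_scale psiP) [in RHS](bigD1 0) //=.
rewrite mulr0 additive_char0 // addrC addrK.
by apply: eq_bigr => s _; rewrite mulrC.
Qed.

Definition kernel_hat (lam : F) (xi : V) : algC :=
  \sum_v sphere_kernel lam v * psi (dotp xi v).

(** For each s the sum over v is a product of d Gauss sums, each contributing [qchar s] and a shift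
    by a multiple of 1 / s. What remains is (gauss 1)^d, of squared modulus q^d, times a twisted
    Kloosterman sum with first coefficient - lam <> 0. *)
Lemma kernel_hat_norm lam xi : lam != 0 ->
  `|kernel_hat lam xi| ^+ 2 <= (4 * q ^ d.+1)%:R.
Proof.
move=> lam0.
have -> : kernel_hat lam xi = gauss psi 1 ^+ d *
   \sum_(s | s != 0) qchar s ^+ d * psi (- lam * s + (- (sqnorm xi / 4%:R)) / s).
  rewrite /kernel_hat /sphere_kernel.
  under eq_bigr => v _ do rewrite mulr_suml.
  rewrite exchange_big /= mulr_sumr; apply: eq_bigr => s s0.
  transitivity (psi (- lam * s) *
      \sum_(v : V) \prod_j psi (s * v ord0 j ^+ 2 + xi ord0 j * v ord0 j)).
    rewrite mulr_sumr; apply: eq_bigr => v _.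
    rewrite -additive_char_sum -!additive_charD //; congr (psi _).
    rewrite big_split /= -mulr_sumr -/(sqnorm v) -/(dotp xi v); ring.
  rewrite (sum_rV_prod (fun j x => psi (s * x ^+ 2 + xi ord0 j * x))).
  under [X in psi _ * X]eq_bigr => j _ do rewrite gauss_linear // gaussE //.
  rewrite big_split /= -additive_char_sum prodr_const card_ord exprMn.
  rewrite -mulr_suml sumrN -mulr_suml -/(sqnorm xi) additive_charD //; ring.
rewrite normrM exprMn normrX exprAC gauss_norm ?oner_neq0 //.
have q0 : (0 : algC) < q%:R by rewrite ltr0n ltnW // card_finField_gt1.
rewrite expnSr mulnCA natrM natrX ler_pM2l ?exprn_gt0 //.
by apply: twisted_kloosterman_bound => //; rewrite oppr_eq0.
Qed.

Definition set_hat (X : {set V}) (xi : V) : algC := \sum_(x in X) psi (dotp xi x).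

Lemma set_hat_parseval (X : {set V}) :
  \sum_xi `|set_hat X xi| ^+ 2 = (q ^ d * #|X|)%:R.
Proof.
transitivity (\sum_(x in X) \sum_(y in X) \sum_xi psi (dotp xi (x - y))).
  under eq_bigr => xi _ do rewrite normCK /set_hat rmorph_sum mulr_suml.
  rewrite exchange_big /=; apply: eq_bigr => x _.
  under eq_bigr => xi _ do rewrite mulr_sumr.
  rewrite exchange_big /=; apply: eq_bigr => y _; apply: eq_bigr => xi _.
  by rewrite additive_char_conj // -additive_charD // dotpBr.
rewrite mulnC natrM -sumr_const mulr_suml; apply: eq_bigr => x xX.
rewrite (bigD1 x) //= [X in _ + X]big1 => [|y /andP [_ yx]].
  by rewrite addr0 mul1r sum_dotp subrr eqxx muln1.
by rewrite sum_dotp subr_eq0 eq_sym (negPf yx) muln0.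
Qed.

Lemma sphere_kernel_pairs lam (X Y : {set V}) : 
  (q ^ d)%:R * \sum_(x in X) \sum_(y in Y) sphere_kernel lam (x - y) =
  \sum_xi kernel_hat lam xi * (set_hat X xi)^* * set_hat Y xi.
Proof.
have inv v : (q ^ d)%:R * sphere_kernel lam v =
    \sum_xi kernel_hat lam xi * psi (- dotp xi v).
  rewrite /kernel_hat.
  under eq_bigr => xi _ do rewrite mulr_suml.
  rewrite exchange_big /= mulrC.
  transitivity (\sum_w sphere_kernel lam w * (q ^ d * (w - v == 0)%R)%N%:R).
    rewrite (bigD1 v) //= subrr eqxx muln1 big1 ?addr0 // => w wv.
    by rewrite subr_eq0 (negPf wv) muln0 mulr0.
  apply: eq_bigr => w _; rewrite -sum_dotp mulr_sumr; apply: eq_bigr => xi _.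
  by rewrite -mulrA -additive_charD // dotpBr.
rewrite mulr_sumr.
under eq_bigr => x _ do [rewrite mulr_sumr; under eq_bigr => y _ do rewrite inv].
rewrite [RHS](eq_bigr (fun xi => \sum_(x in X) \sum_(y in Y)
    kernel_hat lam xi * ((psi (dotp xi x))^* * psi (dotp xi y)))); last first.
  move=> xi _; rewrite -mulrA /set_hat rmorph_sum [X in _ * X]mulr_suml mulr_sumr.
  by apply: eq_bigr => x _; rewrite !mulr_sumr.
rewrite [RHS]exchange_big /=; apply: eq_bigr => x _.
rewrite [RHS]exchange_big /=; apply: eq_bigr => y _; apply: eq_bigr => xi _.
by rewrite additive_char_conj // -additive_charD // dotpBr opprB addrC.
Qed.

End Fourier.

(** Fourier inversion, the kernel bound, Cauchy-Schwarz and Parseval combine to (q^d T)^2 <= 4 q^(d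
    + 1) (q^d |X|) (q^d |Y|). The statement lives in [algR], whose order is total. *)
Lemma distance_pairs (F : finFieldType) (d : nat) (lam : F)
    (X Y : {set 'rV[F]_d}) : odd #|F| -> lam != 0 ->
  ((#|F| * \sum_(x in X) \sum_(y in Y) (sqnorm (x - y) == lam)%R)%N%:R -
   (#|X| * #|Y|)%N%:R) ^+ 2 <= (4 * #|F| ^ d.+1 * #|X| * #|Y|)%N%:R :> algR.
Proof.
move=> oddF lam0; have [psi psiP] := exists_additive_char F.
pose nr (z : algC) : algR := in_algR (normr_real z).
set T := _ - _ : algR.
have TE : \sum_(x in X) \sum_(y in Y) sphere_kernel psi lam (x - y) = algRval T.
  have -> : algRval T = #|F|%:R * (\sum_(x in X) \sum_(y in Y) (sqnorm (x - y) == lam)%R)%N%:R -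
      \sum_(x in X) \sum_(y in Y) 1.
    rewrite /T rmorphB /= !rmorph_nat natrM; congr (_ - _).
    by rewrite sumr_const sumr_const -mulrnA mulnC.
  rewrite natr_sum mulr_sumr -sumrB; apply: eq_bigr => x _.
  rewrite natr_sum mulr_sumr -sumrB; apply: eq_bigr => y _.
  by rewrite sphere_kernelE // natrM.
have q0 : (0 < #|F|)%N := ltnW (card_finField_gt1 F).
have qd0 : (0 : algR) < (#|F| ^ d)%:R by rewrite ltr0n expn_gt0 q0.
have le1 : (#|F| ^ d)%:R * `|T| <=
    \sum_xi nr (kernel_hat psi lam xi) * nr (set_hat psi X xi) * nr (set_hat psi Y xi).
  rewrite -[_ <= _]/(algRval _ <= algRval _) rmorphM rmorph_nat rmorph_sum.
  suff: (#|F| ^ d)%:R * `|algRval T| <=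
      \sum_xi `|kernel_hat psi lam xi| * `|set_hat psi X xi| * `|set_hat psi Y xi| by [].
  rewrite -TE -[X in X * _](normr_nat algC) -normrM sphere_kernel_pairs //.
  apply: le_trans (ler_norm_sum _ _ _) _; apply: ler_sum => xi _.
  by rewrite !normrM norm_conjC.
have parse (Z : {set 'rV[F]_d}) : \sum_xi nr (set_hat psi Z xi) ^+ 2 = (#|F| ^ d * #|Z|)%:R.
  apply: (fmorph_inj algRval); rewrite rmorph_sum rmorph_nat -(set_hat_parseval psiP).
  by apply: eq_bigr => xi _; rewrite rmorphXn.
have CS := @Cauchy_Schwarz_sum _ _ (index_enum 'rV[F]_d)
  (fun xi => nr (kernel_hat psi lam xi) * nr (set_hat psi X xi) * nr (set_hat psi Y xi))
  (fun xi => nr (set_hat psi X xi) ^+ 2) (fun xi => nr (set_hat psi Y xi) ^+ 2)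
  (4 * #|F| ^ d.+1)%:R (ler0n _ _) (fun _ => sqr_ge0 _) (fun _ => sqr_ge0 _).
have H xi : (nr (kernel_hat psi lam xi) * nr (set_hat psi X xi) * nr (set_hat psi Y xi)) ^+ 2 <=
    (4 * #|F| ^ d.+1)%:R * nr (set_hat psi X xi) ^+ 2 * nr (set_hat psi Y xi) ^+ 2.
  rewrite 2!exprMn; do 2!(apply: ler_wpM2r; first exact: sqr_ge0).
  rewrite -[_ <= _]/(algRval _ <= algRval _) rmorphXn rmorph_nat.
  exact: kernel_hat_norm.
have {CS}CS := CS H; rewrite !parse in CS.
have le2 : ((#|F| ^ d)%:R * `|T|) ^+ 2 <= (#|F| ^ d)%:R ^+ 2 * (4 * #|F| ^ d.+1 * #|X| * #|Y|)%:R.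
  apply: le_trans (_ : _ <= (\sum_xi nr (kernel_hat psi lam xi) *
      nr (set_hat psi X xi) * nr (set_hat psi Y xi)) ^+ 2) _.
    have T0 : 0 <= (#|F| ^ d)%:R * `|T| by rewrite mulr_ge0 // ltW.
    by apply: lerXn2r; rewrite ?nnegrE // (le_trans T0 le1).
  apply: (le_trans CS); rewrite -natrX -!natrM ler_nat.
  by move: (#|F| ^ d)%N (#|F| ^ d.+1)%N => u v; nia.
by move: le2; rewrite exprMn real_normK ?num_real // ler_pM2l ?exprn_gt0.
Qed.

(** * Counting realizations of a graph *)

Section Counting.

Variables (F : finFieldType) (d n : nat).
Variables (lam : {set 'I_n} -> F) (A : {set 'rV[F]_d}).
Local Notation V := 'rV[F]_d.
Local Notation T := {ffun 'I_n -> V}.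
Implicit Types (x y : T) (E : {set {set 'I_n}}) (i j k : 'I_n).

Definition realizes E x : bool :=
  [forall i, forall j, ([set i; j] \in E) ==>
     (sqnorm (x i - x j) == lam [set i; j])].

Definition copies E : nat := \sum_(x : T | [forall k, x k \in A]) realizes E x.

(* This stands for the removal of the vertex j, which stays as an isolated
   vertex: counts are multiplied by |A|. *)
Definition edges_off E j := [set e in E | j \notin e].

Definition upd x i (u : V) : T := [ffun k => if k == i then u else x k].

Lemma realizesP E x :
  reflect (forall i j, [set i; j] \in E -> sqnorm (x i - x j) = lam [set i; j])
          (realizes E x).
Proof.
apply: (iffP forallP) => [H i j ij|H i].
  by have /forallP /(_ j) := H i; rewrite ij => /eqP.
by apply/forallP => j; apply/implyP => /H /eqP.
Qed.

Lemma realizes_sub E E' x : E' \subset E -> realizes E x -> realizes E' x.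
Proof. by move=> /subsetP sE /realizesP H; apply/realizesP => i j /sE; apply: H. Qed.

Lemma realizes_off_upd E j x u : realizes (edges_off E j) (upd x j u) = realizes (edges_off E j) x.
Proof.
apply/realizesP/realizesP => H a b ab; rewrite -(H a b ab) !ffunE;
  move: ab; rewrite !inE negb_or => /and3P [_ ja jb];
  by rewrite ![_ == j]eq_sym (negPf ja) (negPf jb).
Qed.

(** Exchanging [x i] with u is an involution on the pairs (x, u). *)
Lemma sum_upd (phi : T -> nat) i :
  (\sum_(x : T | [forall k, x k \in A]) \sum_(u in A) phi (upd x i u) =
   #|A| * \sum_(x : T | [forall k, x k \in A]) phi x)%N.
Proof.
pose h (p : T * V) := (upd p.1 i p.2, p.1 i).
have hK : involutive h.
  move=> [x u]; rewrite /h /= !ffunE eqxx; congr pair.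
  by apply/ffunP => k; rewrite !ffunE; case: eqP => [->|].
rewrite pair_big /= (reindex_inj (inv_inj hK)) /=.
transitivity (\sum_(p : T * V | [forall k, p.1 k \in A] && (p.2 \in A)) phi p.1)%N.
  apply: eq_big => [[x u]|[x u] _] /=; last first.
    by congr phi; apply/ffunP => k; rewrite !ffunE; case: eqP => [->|].
  apply/andP/andP => -[/forallP H xA]; split.
  - by apply/forallP => k; have := H k; rewrite ffunE; case: eqP => [->|].
  - by have := H i; rewrite ffunE eqxx.
  - by apply/forallP => k; rewrite ffunE; case: eqP.
  - exact: H.
rewrite -(pair_big (fun x : T => [forall k, x k \in A]) (fun u : V => u \in A) (fun x _ => phi x)) /=.
by rewrite big_distrr /=; apply: eq_bigr => x _; rewrite sum_nat_const.
Qed.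

Lemma sqnormN (v : V) : sqnorm (- v) = sqnorm v.
Proof. by apply: eq_bigr => j _; rewrite mxE sqrrN. Qed.

Lemma realizesD1 E i j x : [set i; j] \in E ->
  realizes E x = realizes (E :\ [set i; j]) x && (sqnorm (x i - x j) == lam [set i; j]).
Proof.
move=> ijE; apply/idP/andP => [H|[/realizesP H /eqP ij]].
  split; first by apply: realizes_sub H; apply: subsetDl.
  by have /realizesP H' := H; apply/eqP/H'.
apply/realizesP => a b abE; have [E1|ne] := eqVneq [set a; b] [set i; j]; last first.
  by apply: H; rewrite !inE ne.
rewrite E1 -ij.
have : a \in [set i; j] by rewrite -E1 !inE eqxx.
have : b \in [set i; j] by rewrite -E1 !inE eqxx orbT.
have : i \in [set a; b] by rewrite E1 !inE eqxx.
have : j \in [set a; b] by rewrite E1 !inE eqxx orbT.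
rewrite !inE; have [->|ja] := eqVneq j a.
  move=> _; have [->|ia] := eqVneq i a; first by rewrite orbb => _ /eqP -> _.
  by move=> /= /eqP -> _ _; rewrite -sqnormN opprB.
move=> /= /eqP ->; have [->|ib] := eqVneq i a => //= /eqP -> _.
Qed.

(** An edge other than ij misses i or j, so with the other vertices fixed the conditions on u and on
    v are independent. *)
Lemma realizes_del_edge E i j x u v : i != j -> [set i; j] \in E ->
  (forall e, e \in E -> #|e| = 2%N) ->
  realizes (E :\ [set i; j]) (upd (upd x i u) j v) =
  realizes (edges_off E j) (upd x i u) && realizes (edges_off E i) (upd x j v).
Proof.
move=> ij ijE E2; set y := upd (upd x i u) j v.
have yj : realizes (edges_off E j) y = realizes (edges_off E j) (upd x i u).
  exact: realizes_off_upd.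
have yE : y = upd (upd x j v) i u.
  apply/ffunP => k; rewrite !ffunE; case: (eqVneq k j) => [->|//].
  by rewrite eq_sym (negPf ij).
have yi : realizes (edges_off E i) y = realizes (edges_off E i) (upd x j v).
  by rewrite yE realizes_off_upd.
rewrite -yj -yi; apply/idP/andP => [H|[/realizesP Hj /realizesP Hi]].
  split; apply: realizes_sub H; apply/subsetP => e; rewrite !inE => /andP [eE ne];
    rewrite eE andbT; apply: contraNneq ne => ->; by rewrite !inE eqxx ?orbT.
apply/realizesP => a b; rewrite inE => /andP [ne abE].
have [jab|jab] := boolP (j \in [set a; b]); last first.
  by apply: Hj; rewrite inE abE.
apply: Hi; rewrite inE abE; apply: contra ne => iab.
rewrite inE eq_sym eqEcard subUset !sub1set iab jab /=.
by rewrite (E2 _ abE) cards2 ij.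
Qed.

Lemma realizes_edge E i j x u v : i != j -> [set i; j] \in E ->
  (forall e, e \in E -> #|e| = 2%N) ->
  realizes E (upd (upd x i u) j v) =
  [&& realizes (edges_off E j) (upd x i u), realizes (edges_off E i) (upd x j v) &
      sqnorm (u - v) == lam [set i; j]].
Proof.
move=> ij ijE E2; rewrite (realizesD1 _ ijE) realizes_del_edge // -andbA.
by rewrite !ffunE !eqxx (negPf ij).
Qed.

(** For fixed x, [X x] and [Y x] are the admissible positions of i and j; [distance_pairs] applies
    to them, and Cauchy-Schwarz sums over x. The entries of x at i and j are dummies, which is where
    the powers of |A| come from. *)
Lemma copies_edge E i j :
  odd #|F| -> lam [set i; j] != 0 -> i != j -> [set i; j] \in E ->
  (forall e, e \in E -> #|e| = 2%N) -> (0 < #|A|)%N ->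
  ((#|A| * (#|F| * copies E))%:R - (#|A| * copies (E :\ [set i; j]))%:R) ^+ 2 <=
  (4 * #|F| ^ d.+1 * copies (edges_off E j) * copies (edges_off E i))%:R :> algR.
Proof.
move=> oddF lam0 ij ijE E2 A0.
pose X x := [set u in A | realizes (edges_off E j) (upd x i u)].
pose Y x := [set v in A | realizes (edges_off E i) (upd x j v)].
pose P x := [forall k, x k \in A].
have sumX : (\sum_(x : T | P x) #|X x| = #|A| * copies (edges_off E j))%N.
  rewrite /copies -(sum_upd _ i); apply: eq_bigr => x _.
  rewrite -sum1_card big_mkcond [RHS]big_mkcond /=; apply: eq_bigr => u _.
  by rewrite inE; case: (u \in A) => //=; case: realizes.
have sumY : (\sum_(x : T | P x) #|Y x| = #|A| * copies (edges_off E i))%N.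
  rewrite /copies -(sum_upd _ j); apply: eq_bigr => x _.
  rewrite -sum1_card big_mkcond [RHS]big_mkcond /=; apply: eq_bigr => u _.
  by rewrite inE; case: (u \in A) => //=; case: realizes.
have dbl (phi : T -> nat) : (\sum_(x : T | P x) \sum_(u in A) \sum_(v in A)
    phi (upd (upd x i u) j v) = #|A| * (#|A| * \sum_(x : T | P x) phi x))%N.
  by rewrite (sum_upd (fun x => \sum_(v in A) phi (upd x j v))%N i) sum_upd.
have sumE : (\sum_(x : T | P x) \sum_(u in X x) \sum_(v in Y x)
    (sqnorm (u - v) == lam [set i; j])%R = #|A| * (#|A| * copies E))%N.
  rewrite /copies -dbl; apply: eq_bigr => x _.
  rewrite [LHS]big_mkcond [RHS]big_mkcond /=; apply: eq_bigr => u _.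
  rewrite inE; case: (u \in A) => //=; case: ifPn => [ru|nu]; last first.
    by rewrite big1 // => v _; rewrite realizes_edge // (negPf nu).
  rewrite [LHS]big_mkcond [RHS]big_mkcond /=; apply: eq_bigr => v _.
  by rewrite inE realizes_edge // ru; case: (v \in A) => //=; case: realizes.
have sumE' : (\sum_(x : T | P x) #|X x| * #|Y x| =
    #|A| * (#|A| * copies (E :\ [set i; j])))%N.
  rewrite /copies -dbl; apply: eq_bigr => x _.
  rewrite -sum_nat_const [LHS]big_mkcond [RHS]big_mkcond /=; apply: eq_bigr => u _.
  rewrite inE; case: (u \in A) => //=; case: ifPn => [ru|nu]; last first.
    by rewrite big1 // => v _; rewrite realizes_del_edge // (negPf nu).
  rewrite -sum1_card [LHS]big_mkcond [RHS]big_mkcond /=; apply: eq_bigr => v _.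
  by rewrite inE realizes_del_edge // ru; case: (v \in A) => //=; case: realizes.
pose D x : algR :=
  ((#|F| * \sum_(u in X x) \sum_(v in Y x) (sqnorm (u - v) == lam [set i; j])%R)%N%:R -
   (#|X x| * #|Y x|)%N%:R).
have HD x : D x ^+ 2 <= (4 * #|F| ^ d.+1)%:R * (#|X x|)%:R * (#|Y x|)%:R.
  by rewrite -!natrM; apply: distance_pairs.
have := Cauchy_Schwarz_sum [seq x <- index_enum T | P x] (ler0n _ _)
  (fun x => ler0n _ #|X x|) (fun x => ler0n _ #|Y x|) HD.
rewrite !big_filter sumrB -!natr_sum sumX sumY -big_distrr /= sumE sumE'.
have a0 : (0 : algR) < #|A|%:R by rewrite ltr0n.
move=> H; rewrite -(ler_pM2l (exprn_gt0 2 a0)); move: H; rewrite !natrM.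
move: (#|A|%:R) (#|F|%:R) (#|F| ^ d.+1)%:R (copies _)%:R (copies _)%:R (copies _)%:R (copies _)%:R.
move=> ra rq rQ r1 r2 r3 r4 H; lra.
Qed.

Lemma copies0 : copies set0 = (#|A| ^ n)%N.
Proof.
rewrite /copies (eq_bigr (fun=> 1%N)); last first.
  by move=> x _; rewrite (introT (realizesP _ _)) // => i j; rewrite inE.
rewrite sum1_card -[n in RHS]card_ord -card_ffun_on.
by apply: eq_card => x; rewrite [LHS]unfold_in; apply/forallP/ffun_onP.
Qed.

Lemma card_edges_off E j : (#|edges_off E j| + vdeg E j = #|E|)%N.
Proof.
rewrite -(cardsID [set e : {set 'I_n} | j \in e] E) addnC; congr (_ + _)%N.
  by apply: eq_card => e; rewrite !inE.
by apply: eq_card => e; rewrite !inE andbC.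
Qed.

Lemma card_edges E : (forall e, e \in E -> #|e| = 2%N) -> (2 * #|E| <= n ^ 2)%N.
Proof.
move=> E2; apply: (@leq_trans (2 * 'C(n, 2))).
  rewrite leq_mul2l /= -[n in 'C(n, _)]card_ord -card_draws; apply: subset_leq_card.
  by apply/subsetP => e /E2 e2; rewrite inE e2.
rewrite bin2 mul2n halfK (leq_trans (leq_subr _ _)) // -mulnn leq_mul2l leq_pred orbT //.
Qed.

End Counting.

(** * Asymptotic number of realizations *)

Section Asymptotics.

Variables (F : finFieldType) (d n : nat).
Variables (lam : {set 'I_n} -> F) (A : {set 'rV[F]_d}).
Local Notation copies := (copies lam A).
Implicit Types E : {set {set 'I_n}}.

(** There are at most n^2 / 2 edges, so the total relative error is at most 1/11. *)
Lemma copies_upper (C : algR) E : (0 < n)%N ->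
  (forall e, e \in E -> #|e| = 2%N) -> 0 <= C ->
  `|(copies E * #|F| ^ #|E|)%:R - C| <= #|E|%:R * (2%:R / (11%:R * n%:R ^+ 2)) * C ->
  (copies E * #|F| ^ #|E|)%:R <= 12%:R / 11%:R * C /\
  10%:R / 11%:R * C <= (copies E * #|F| ^ #|E|)%:R.
Proof.
move=> n0 E2 C0 H.
have nn : (0 : algR) < n%:R ^+ 2 by rewrite exprn_gt0 // ltr0n.
have E1 : #|E|%:R * (2%:R / (11%:R * n%:R ^+ 2)) <= 11%:R^-1 :> algR.
  rewrite mulrA ler_pdivrMr ?mulr_gt0 ?ltr0n // mulrA mulVf ?pnatr_eq0 // mul1r.
  by rewrite mulrC -natrM -natrX ler_nat card_edges.
have := le_trans H (ler_wpM2r C0 E1); rewrite ler_distl => /andP [].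
move: (copies E * _)%:R => N; clear; move=> h1 h2; split; lra.
Qed.

(** The density hypothesis is squared to keep exponents integral. The induction covers all proper
    subgraphs, because adding ij uses both E minus ij and the graphs without i or j, the latter
    bounded by 12/11 of their expected count. *)
Lemma copies_asymptotic t E :
  odd #|F| -> (0 < d)%N -> (0 < n)%N ->
  (144 * n ^ 4 * #|F| ^ (2 * t) * #|F| ^ d.-1 <= #|A| ^ 2)%N ->
  (forall e, e \in E -> #|e| = 2%N /\ lam e != 0) ->
  (forall v, vdeg E v <= t)%N ->
  `|(copies E * #|F| ^ #|E|)%:R - (#|A| ^ n)%:R| <=
  #|E|%:R * (2%:R / (11%:R * n%:R ^+ 2)) * (#|A| ^ n)%:R :> algR.
Proof.
move=> oddF d0 n0 Abig; have q0 : (0 < #|F|)%N := ltnW (card_finField_gt1 F).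
have A0 : (0 < #|A|)%N.
  have : (0 < #|A| ^ 2)%N by apply: leq_trans Abig; rewrite !muln_gt0 !expn_gt0 q0 n0.
  by rewrite expn_gt0 orbF.
have [m Em] := ubnP #|E|; elim: m E Em => // m IH E Em HE degE.
have E2 e : e \in E -> #|e| = 2%N by case/HE.
case: (set_0Vmem E) => [E0|[e eE]].
  by rewrite E0 copies0 cards0 muln1 subrr normr0 !mul0r.
have [e2 lame] := HE e eE.
have /cards2P [i [j [ij Ee]]] : #|e| == 2%N by rewrite e2.
subst e.
have sub_ok E' : E' \proper E -> `|(copies E' * #|F| ^ #|E'|)%:R - (#|A| ^ n)%:R| <=
    #|E'|%:R * (2%:R / (11%:R * n%:R ^+ 2)) * (#|A| ^ n)%:R :> algR.
  move=> pE; have /properP [/subsetP sE _] := pE; apply: IH.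
  - by apply: (leq_trans (proper_card pE)); rewrite -ltnS.
  - by move=> f /sE /HE.
  - move=> v; apply: leq_trans (degE v); apply: subset_leq_card.
    by apply/subsetP => f; rewrite !inE => /andP [/sE -> ->].
have off_ok k : k \in [set i; j] ->
    (copies (edges_off E k) * #|F| ^ #|edges_off E k|)%:R <= 12%:R / 11%:R * (#|A| ^ n)%:R :> algR.
  move=> kij; have pE : edges_off E k \proper E.
    apply/properP; split; first by apply/subsetP => f; rewrite inE => /andP [].
    by exists [set i; j] => //; rewrite inE kij andbF.
  have /properP [/subsetP sE _] := pE.
  by have [] := copies_upper n0 (fun f fE => E2 f (sE f fE)) (ler0n _ _) (sub_ok _ pE).
have H := copies_edge oddF lame ij eE E2 A0.
have iE := off_ok i; rewrite !inE eqxx in iE; have {}iE := iE isT.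
have jE := off_ok j; rewrite !inE eqxx orbT in jE; have {}jE := jE isT.
have IHe := sub_ok (E :\ [set i; j]) (properD1 eE).
have cE := cardsD1 [set i; j] E; rewrite eE /= in cE.
have ci := card_edges_off E i; have cj := card_edges_off E j.
have di := degE i; have dj := degE j.
set c := 2%:R / _ in IHe *; set C := (#|A| ^ n)%:R in iE jE IHe *.
suff step : `|(copies E * #|F| ^ #|E|)%:R -
     (copies (E :\ [set i; j]) * #|F| ^ #|E :\ [set i; j]|)%:R| <= c * C.
  have := ler_distD ((copies (E :\ [set i; j]) * #|F| ^ #|E :\ [set i; j]|)%:R : algR)
    (copies E * #|F| ^ #|E|)%:R C.
  move/le_trans; apply; rewrite [in X in _ <= X]cE natrD !mulrDl mul1r.
  exact: lerD.
set N := copies E in H *; set N' := copies (E :\ _) in H *.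
set Ni := copies (edges_off E i) in H iE; set Nj := copies (edges_off E j) in H jE.
clearbody N N' Ni Nj.
pose z := (#|F| ^ #|E :\ [set i; j]|)%N.
have Ez : (#|F| ^ #|E| = #|F| * z)%N by rewrite cE expnD expn1.
rewrite -/z; clearbody z.
 have C0 : 0 <= C by rewrite ler0n.
have a0 : (0 : algR) < #|A|%:R by rewrite ltr0n.
have n0' : (0 : algR) < n%:R by rewrite ltr0n.
pose w : algR := (N * #|F| ^ #|E|)%:R - (N' * z)%:R.
rewrite -/w.
(* The edges lost with i and j number at most t each, whence the factor q^(2 t); multiplying by q^(2
   |E|) and dividing by q^2 turns q^(d + 1) into q^(d - 1). *)
have H1 : (#|A|%:R * w) ^+ 2 <= 4%:R * (#|F| ^ d.-1)%:R * (#|F| ^ (2 * t))%:R * (12%:R / 11%:R * C) ^+ 2.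
  have E1 : (#|A|%:R * w) ^+ 2 =
      ((#|A| * (#|F| * N))%:R - (#|A| * N')%:R) ^+ 2 * (z%:R) ^+ 2.
    by rewrite /w Ez !natrM; ring.
  rewrite E1; apply: (le_trans (ler_wpM2r (sqr_ge0 _) H)).
  have E3 : (4 * #|F| ^ d.+1 * Nj * Ni)%:R * z%:R ^+ 2 =
      4%:R * (#|F| ^ d.-1)%:R * (#|F| ^ (vdeg E i + vdeg E j))%:R *
      ((Nj * #|F| ^ #|edges_off E j|)%:R * (Ni * #|F| ^ #|edges_off E i|)%:R) :> algR.
    rewrite -natrX -!natrM; congr (_%:R).
    have -> : (4 * #|F| ^ d.+1 * Nj * Ni * z ^ 2 = 4 * #|F| ^ d.-1 * Nj * Ni * (#|F| * z) ^ 2)%N.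
      have -> : (#|F| ^ d.+1 = #|F| * (#|F| * #|F| ^ d.-1))%N by rewrite -!expnS prednK.
      by rewrite -!mulnn; clear -F z Ni Nj; move: (#|F| ^ d.-1)%N (#|F|) => u v; ring.
    rewrite -Ez -mulnn -{1}ci -{1}cj !expnD.
    move: (#|F| ^ d.-1)%N (#|F| ^ vdeg E i)%N (#|F| ^ vdeg E j)%N
      (#|F| ^ #|edges_off E i|)%N (#|F| ^ #|edges_off E j|)%N.
    by move=> u1 u2 u3 u4 u5; ring.
  rewrite E3; apply: ler_pM; rewrite ?mulr_ge0 ?ler0n //.
    by rewrite ler_wpM2l ?mulr_ge0 ?ler0n // ler_nat leq_exp2l ?card_finField_gt1 // mul2n -addnn leq_add.
  by rewrite expr2; apply: ler_pM; rewrite ?ler0n.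
have Abig' : 144%:R * n%:R ^+ 4 * (#|F| ^ (2 * t))%:R * (#|F| ^ d.-1)%:R <= #|A|%:R ^+ 2 :> algR.
  by rewrite -!natrX -!natrM ler_nat.
(* Here 144 n^4 / 4 = (6 n^2)^2, and 12/11 divided by 6 n^2 is the error 2 / (11 n^2) granted to one
   edge. *)
have H2 : (6%:R * n%:R ^+ 2 * w) ^+ 2 <= (12%:R / 11%:R * C) ^+ 2.
  rewrite -(ler_pM2l (exprn_gt0 2 a0)).
  move: H1 Abig' (sqr_ge0 (12%:R / 11%:R * C)); rewrite exprMn.
  move: (12%:R / 11%:R * C) (#|F| ^ (2 * t))%:R (#|F| ^ d.-1)%:R (#|A|%:R ^+ 2) => u x y aa h1 h2 u0.
  have h3 := ler_wpM2r u0 h2.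
  have h4 := ler_wpM2l (exprn_ge0 4 (ltW n0')) h1.
  move: h3 h4; clear; move: (n%:R) (w) => v1 v2; lra.
have H3 : 6%:R * n%:R ^+ 2 * `|w| <= 12%:R / 11%:R * C.
  have P1 : 0 <= 6%:R * n%:R ^+ 2 * `|w| by rewrite !mulr_ge0 ?ler0n // exprn_ge0 // ltW.
  have P2 : 0 <= 12%:R / 11%:R * C by rewrite mulr_ge0 // divr_ge0 ?ler0n.
  rewrite -(ler_pXn2r (n := 2)) ?nnegrE //.
  by rewrite exprMn real_normK ?num_real // -exprMn.
rewrite /c -mulrAC ler_pdivlMr ?mulr_gt0 ?exprn_gt0 //.
clearbody C; move: H3; clear -C w n; move: (n%:R ^+ 2) (`|w|) => u v H3; lra.
Qed.

End Asymptotics.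

(** * Discarding non-injective realizations *)

Section Injectivity.

Variables (F : finFieldType) (d n : nat).
Variables (lam : {set 'I_n} -> F) (A : {set 'rV[F]_d}).
Local Notation copies := (copies lam A).
Local Notation T := {ffun 'I_n -> 'rV[F]_d}.
Implicit Types E : {set {set 'I_n}}.

Definition coincidences E (p : 'I_n * 'I_n) : nat :=
  \sum_(x : T | [forall k, x k \in A]) (realizes lam E x && (x p.1 == x p.2)).

(** After the edges at j are dropped, the position of j is free in A, whereas the coincidence pins
    it to that of i: a factor |A| is gained. *)
Lemma coincidences_le E i j : i != j ->
  (#|A| * coincidences E (i, j) <= copies (edges_off E j))%N.
Proof.
move=> ij; apply: (@leq_trans (#|A| * \sum_(x : T | [forall k, x k \in A])
    (realizes lam (edges_off E j) x && (x i == x j)))).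
  rewrite leq_mul2l; apply/orP; right; apply: leq_sum => x _ /=.
  have [/(realizes_sub (_ : edges_off E j \subset E)) -> //|//] := boolP (realizes lam E x).
  by apply/subsetP => e; rewrite inE => /andP [].
rewrite -(sum_upd A (fun x => realizes lam (edges_off E j) x && (x i == x j) : nat) j).
apply: leq_sum => x _.
under eq_bigr => u _ do rewrite realizes_off_upd !ffunE (negPf ij) eqxx.
case: realizes => /=; last by rewrite big1.
rewrite big_mkcond (bigD1 (x i)) //= eqxx big1 => [|u ne]; first by case: (x i \in A).
by rewrite eq_sym (negPf ne); case: (u \in A).
Qed.

Lemma card_iso_copies E :
  (copies E <= #|iso_copies E lam A| +
     \sum_(p : 'I_n * 'I_n | p.1 != p.2) coincidences E p)%N.
Proof.
have -> : #|iso_copies E lam A| =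
    (\sum_(x : T | [forall k, x k \in A]) (injectiveb x && realizes lam E x))%N.
  rewrite -sum1_card big_mkcond [RHS]big_mkcond /=; apply: eq_bigr => x _.
  by rewrite inE -/(realizes lam E x) andbCA; case: [forall k, _] => //=; case: (_ && _).
rewrite /coincidences exchange_big /= -big_split /=; apply: leq_sum => x _.
case: realizes; last by rewrite andbF.
rewrite andbT; case: injectiveP => //= /injectiveP/injectivePn [i [j ij xij]].
by rewrite (bigD1 (i, j)) //= xij eqxx.
Qed.

(** A coincidence gains |A| >= 12 n^2 q^t and loses at most q^t from the edges at j, so the at most
    n^2 pairs cost 1/11 of the expected count in all. This leaves 9/11, more than 1/2. *)
Lemma iso_copies_lower t E :
  odd #|F| -> (0 < d)%N -> (0 < n)%N ->
  (144 * n ^ 4 * #|F| ^ (2 * t) * #|F| ^ d.-1 <= #|A| ^ 2)%N ->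
  (forall e, e \in E -> #|e| = 2%N /\ lam e != 0) ->
  (forall v, vdeg E v <= t)%N ->
  (#|A| ^ n <= 2 * (#|iso_copies E lam A| * #|F| ^ #|E|))%N.
Proof.
move=> oddF d0 n0 Abig HE degE; have q0 : (0 < #|F|)%N := ltnW (card_finField_gt1 F).
have E2 e : e \in E -> #|e| = 2%N by case/HE.
have lowE := (copies_upper n0 E2 (ler0n _ _) (copies_asymptotic oddF d0 n0 Abig HE degE)).2.
have Alarge : (12 * n ^ 2 * #|F| ^ t <= #|A|)%N.
  rewrite -leq_sqr; apply: leq_trans Abig.
  have <- : ((12 * n ^ 2 * #|F| ^ t) ^ 2 = 144 * n ^ 4 * #|F| ^ (2 * t))%N.
    by rewrite (mulnC 2%N t) expnM; move: (#|F| ^ t)%N => u; ring.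
  by rewrite leq_pmulr // expn_gt0 q0.
have A0 : (0 < #|A|)%N by apply: leq_trans Alarge; rewrite !muln_gt0 !expn_gt0 q0 n0.
have coin p : p.1 != p.2 ->
    (11 * (#|A| * coincidences E p * #|F| ^ #|E|) <= 12 * #|A| ^ n * #|F| ^ t)%N.
  case: p => i j /= ij.
  have sE : edges_off E j \subset E by apply/subsetP => e; rewrite inE => /andP [].
  have HEj e : e \in edges_off E j -> #|e| = 2%N /\ lam e != 0 by move/(subsetP sE)/HE.
  have degEj v : (vdeg (edges_off E j) v <= t)%N.
    apply: leq_trans (degE v); apply: subset_leq_card.
    by apply/subsetP => e; rewrite !inE => /andP [/andP [-> _] ->].
  have := (copies_upper n0 (fun e eE => E2 e (subsetP sE e eE)) (ler0n _ _)
    (copies_asymptotic oddF d0 n0 Abig HEj degEj)).1.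
  rewrite mulrAC ler_pdivlMr ?ltr0n // mulrC -!natrM ler_nat => up.
  have c1 := coincidences_le E ij.
  have : (#|F| ^ #|E| <= #|F| ^ #|edges_off E j| * #|F| ^ t)%N.
    by rewrite -expnD leq_exp2l ?card_finField_gt1 // -(card_edges_off E j) leq_add2l.
  move: up c1; move: (#|A| * _)%N (copies _) (#|A| ^ n)%N (#|F| ^ t)%N (#|F| ^ #|E|)%N (#|F| ^ _)%N.
  clear; move=> c N a u v w h1 h2 h3.
  apply: (@leq_trans (11 * (N * (w * u)))); first by rewrite leq_mul2l leq_mul.
  by rewrite !mulnA leq_mul2r -mulnA h1 orbT.
have sumc : (11 * ((\sum_(p : 'I_n * 'I_n | p.1 != p.2) coincidences E p) * #|F| ^ #|E|) <= #|A| ^ n)%N.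
  rewrite -(leq_pmul2l A0) mulnCA mulnA.
  rewrite big_distrl !big_distrr /=.
  apply: (@leq_trans (\sum_(p : 'I_n * 'I_n | p.1 != p.2) 12 * #|A| ^ n * #|F| ^ t)%N).
    by apply: leq_sum => p /coin; rewrite !mulnA.
  rewrite sum_nat_const.
  apply: (@leq_trans (n ^ 2 * (12 * #|A| ^ n * #|F| ^ t))%N).
    rewrite leq_mul2r; apply/orP; right; apply: (leq_trans (max_card _)).
    by rewrite card_prod card_ord mulnn.
  rewrite (_ : _ * _ = 12 * n ^ 2 * #|F| ^ t * #|A| ^ n)%N ?leq_mul2r ?Alarge ?orbT //.
  by move: (n ^ 2)%N (#|A| ^ n)%N (#|F| ^ t)%N => u v w; ring.
have := card_iso_copies E.
move: lowE sumc; rewrite mulrAC ler_pdivrMr ?ltr0n // [leRHS]mulrC -!natrM ler_nat.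
move: (#|iso_copies E lam A|) (copies E) (\sum_(p | _) _)%N (#|A| ^ n)%N (#|F| ^ _)%N.
clear; move=> I N S a u h1 h2 h3.
have : (N * u <= I * u + S * u)%N by rewrite -mulnDl leq_mul2r h3 orbT.
move: (N * u)%N (I * u)%N (S * u)%N h1 h2 => x y z; lia.
Qed.

End Injectivity.

Theorem theorem5p2 (F : finFieldType) (d n t : nat)
  (E : {set {set 'I_n}}) (lam : {set 'I_n} -> F) (A : {set 'rV[F]_d}) :
  odd #|F| -> (0 < d)%N ->
  is_distance_graph E lam ->
  (\max_(v : 'I_n) vdeg E v)%N = t ->
  (* alpha := |A| / q^d >= 12 n^2 q^(t - (d+1)/2) *)
  (#|A|%:R / (#|F|%:R ^+ d) : algC) >=
    12%:R * (n%:R ^+ 2) * (#|F|%:R ^+ t) / (sqrtC (#|F|%:R) ^+ d.+1) ->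
  (#|iso_copies E lam A|%:R : algC) >=
    2%:R^-1 * (#|A|%:R ^+ n) / (#|F|%:R ^+ #|E|).
Proof.
move=> oddF d0 HE degE Hbig.
have q0 : (0 < #|F|)%N := ltnW (card_finField_gt1 F).
have qE0 : (0 : algC) < #|F|%:R ^+ #|E| by rewrite exprn_gt0 ?ltr0n.
suff main : (#|A| ^ n <= 2 * (#|iso_copies E lam A| * #|F| ^ #|E|))%N.
  rewrite ler_pdivrMr // mulrC ler_pdivrMr ?ltr0n // [leRHS]mulrC.
  by rewrite -!natrX -!natrM ler_nat.
(* Without vertices the empty map is a copy and |A|^0 = 1. *)
have [n0|n0] := posnP n.
  have noI (i : 'I_n) : False by have := leq_ltn_trans (leq0n i) (ltn_ord i); rewrite n0.
  have : [ffun=> 0] \in iso_copies E lam A.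
    rewrite inE; apply/and3P; split.
    - by apply/injectiveP => i; case: (noI i).
    - by apply/forallP => i; case: (noI i).
    - by apply/forallP => i; case: (noI i).
  move=> xin; have c0 : (0 < #|iso_copies E lam A|)%N by apply/card_gt0P; exists [ffun=> 0].
  have -> : (#|A| ^ n = 1)%N by rewrite n0.
  have : (0 < #|F| ^ #|E|)%N by rewrite expn_gt0 q0.
  by move: c0 => c0 c1; rewrite muln_gt0 muln_gt0 c0 c1.
apply: (@iso_copies_lower _ _ _ _ _ t) => //; last first.
  by move=> v; rewrite -degE; apply: leq_bigmax.
set s := sqrtC _ in Hbig.
have s2 : s ^+ 2 = #|F|%:R by rewrite sqrtCK.
have s0 : 0 < s by rewrite sqrtC_gt0 ltr0n.
(* With s = sqrt q, q^d = s^(d + 1) s^(d - 1) clears the denominator; squaring then removes s. *)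
have B1 : 12%:R * n%:R ^+ 2 * #|F|%:R ^+ t * s ^+ d.-1 <= #|A|%:R.
  have qd : #|F|%:R ^+ d = s ^+ d.+1 * s ^+ d.-1.
    by rewrite -s2 -exprM -exprD; congr (_ ^+ _); lia.
  move: Hbig; rewrite ler_pdivlMr ?exprn_gt0 ?ltr0n // qd.
  by rewrite mulrA divfK // expf_neq0 // lt0r_neq0.
have L0 : 0 <= 12%:R * n%:R ^+ 2 * #|F|%:R ^+ t * s ^+ d.-1 :> algC.
  by rewrite mulr_ge0 ?exprn_ge0 ?(ltW s0) // -!natrX -!natrM ler0n.
have B2 : (12%:R * n%:R ^+ 2 * #|F|%:R ^+ t * s ^+ d.-1) ^+ 2 <= #|A|%:R ^+ 2.
  by apply: lerXn2r; rewrite ?nnegrE ?ler0n.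
rewrite -(ler_nat algC) natrX; apply: le_trans B2.
rewrite [leRHS]exprMn (exprAC _ d.-1) s2 mulnC (mulnC 2%N t) expnM.
rewrite !natrM !natrX; move: (#|F|%:R ^+ t) (#|F|%:R ^+ d.-1) => u v.
by rewrite le_eqVlt; apply/orP; left; apply/eqP; ring.
Qed.
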